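(* Let $n\ge 2$ and $1\le \ell\le n-1$ be integers, and for $s\in[0,1]$ let $$d\nu(s)=s^{\ell/2-1}(1-s)^{(n-\ell)/2-1}\,ds .$$ An integrable function $f$ on the unit sphere $S^{n-1}\subset\mathbb{R}^n$ is $K_\ell$-invariant if and only if there is a function $f_0\in L^1([0,1];d\nu)$ such that $f(\theta)=f_0(s)$, where $s=\theta^t\,\mathrm{Pr}_{\mathbb{R}^\ell}\,\theta$ (so that $s^{1/2}=(\theta^t\,\mathrm{Pr}_{\mathbb{R}^\ell}\,\theta)^{1/2}$ is the cosine of the angle between the unit vector $\theta$ and the coordinate subspace $\mathbb{R}^\ell$). Moreover, $$\int_{S^{n-1}} f(\theta)\,d\theta = c\int_0^{\pi/2} f_0(\cos^2\omega)\,\sin^{n-\ell-1}\omega\,\cos^{\ell-1}\omega\,d\omega=\frac{c}{2}\int_0^1 f_0(s)\,d\nu(s),\qquad c=\sigma_{\ell-1}\,\sigma_{n-\ell-1}.$$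
   Context: Let $e_1,\dots,e_n$ be the coordinate unit vectors of $\mathbb{R}^n$ and write $\mathbb{R}^n=\mathbb{R}^{n-\ell}\oplus\mathbb{R}^\ell$ with $\mathbb{R}^{n-\ell}=\bigoplus_{j=1}^{n-\ell}\mathbb{R}e_j$ and $\mathbb{R}^\ell=\bigoplus_{j=n-\ell+1}^{n}\mathbb{R}e_j$. $\mathrm{Pr}_{\mathbb{R}^\ell}$ denotes the ($n\times n$ matrix of the) orthogonal projection of $\mathbb{R}^n$ onto this coordinate subspace $\mathbb{R}^\ell$. Vectors are columns and $^t$ denotes transpose. $K_\ell=\left\{\begin{bmatrix}\alpha&0\\0&\beta\end{bmatrix} : \alpha\in \mathrm{O}(n-\ell),\ \beta\in\mathrm{O}(\ell)\right\}\subset \mathrm{O}(n)$. A function $f$ on $S^{n-1}$ is $K_\ell$-invariant if $f(\gamma\theta)=f(\theta)$ for all $\gamma\in K_\ell$. $d\theta$ is the usual (non-normalized) surface measure on $S^{n-1}$, and ''integrable'' refers to it. For $k\ge 1$, $\sigma_{k-1}=2\pi^{k/2}/\Gamma(k/2)$ is the area of the unit sphere $S^{k-1}$ in $\mathbb{R}^k$ (so $\sigma_0=2$). *)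

(* Defs.v *)
From HB Require Import structures.
From mathcomp Require Import all_boot all_order all_algebra.
From mathcomp Require Import all_classical all_reals all_analysis.
From mathcomp Require Import measurable_realfun.

Set Implicit Arguments.
Unset Strict Implicit.
Unset Printing Implicit Defensive.
Import Order.TTheory GRing.Theory Num.Theory.
Import numFieldNormedType.Exports.

Local Open Scope classical_set_scope.
Local Open Scope ring_scope.

(* The sigma-algebra on column vectors is generated by the coordinates, like  *)
(* the library's one on tuples; this is the Borel sigma-algebra of R^n.       *)
Section measurable_cV.
Context {R : realType} {n : nat}.

Let coord : 'I_n -> 'cV[R]_n -> R := fun i x => x i ord0.

Let cV_set0 : g_sigma_preimage coord set0.
Proof. exact: sigma_algebra0. Qed.

Let cV_setC A : g_sigma_preimage coord A -> g_sigma_preimage coord (~` A).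
Proof. exact: sigma_algebraC. Qed.

Let cV_bigcup (F : _^nat) : (forall i, g_sigma_preimage coord (F i)) ->
  g_sigma_preimage coord (\bigcup_i (F i)).
Proof. exact: sigma_algebra_bigcup. Qed.

HB.instance Definition _ :=
  @isMeasurable.Build (measure_tuple_display default_measure_display)
    'cV[R]_n (g_sigma_preimage coord) cV_set0 cV_setC cV_bigcup.

End measurable_cV.

Lemma measurable_cV_coord (R : realType) n (i : 'I_n) :
  measurable_fun [set: 'cV[R]_n] (fun x : 'cV[R]_n => x i ord0).
Proof.
move=> _ Y mY; rewrite setTI; apply: sub_sigma_algebra => /=.
rewrite -bigcup_seq/=; exists i => /=; first by rewrite mem_index_enum.
by exists Y => //; rewrite setTI.
Qed.

Lemma measurable_fun_cV d (T : measurableType d) (R : realType) n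
    (f : T -> 'cV[R]_n) :
  (forall i, measurable_fun [set: T] (fun x => f x i ord0)) ->
  measurable_fun [set: T] f.
Proof.
move=> mf _ A mA; rewrite setTI.
suff: @g_sigma_preimage _ R _ n (fun i x => f x i ord0) `<=` measurable.
  apply; rewrite (_ : (fun i x => _) =
    (fun i => (fun x : 'cV[R]_n => x i ord0) \o f))//.
  by rewrite g_sigma_preimage_comp; exists A => //; rewrite setTI.
apply: smallest_sub; first exact: sigma_algebra_measurable.
case: n => [|n] in f mf A mA *; first by rewrite big_ord0.
rewrite -bigcup_mkord_ord; apply: bigcup_sub => i Ii.
by move=> A' [B mB <-]; exact: mf.
Qed.

Definition cV_cons (R : realType) n (p : measurableTypeR R * 'cV[R]_n) :
  'cV[R]_n.+1 := col_mx (p.1 : R)%:M p.2.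

Lemma measurable_cV_cons (R : realType) n :
  measurable_fun [set: measurableTypeR R * 'cV[R]_n] (@cV_cons R n).
Proof.
apply: measurable_fun_cV => i; rewrite /cV_cons.
have [j ->|j ->] := split_ordP (i : 'I_(1 + n)).
  rewrite (_ : (fun x => _) = fst); first exact: measurable_fst.
  apply/funext => p; rewrite ord1; apply: etrans (col_mxEu _ _ _ _) _.
  by rewrite mxE eqxx.
rewrite (_ : (fun x => _) = (fun x : 'cV[R]_n => x j ord0) \o snd); last first.
  by apply/funext => p; exact: col_mxEd.
exact: (measurableT_comp (measurable_cV_coord j) measurable_snd).
Qed.

Section lebesgue_cV_step.
Context {R : realType} {n : nat}.
Variable m : {sigma_finite_measure set 'cV[R]_n -> \bar R}.
Local Open Scope ereal_scope.

Definition lebesgue_cV_step : set 'cV[R]_n.+1 -> \bar R :=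
  pushforward (@lebesgue_measure R \x m) (@cV_cons R n).

Let step0 : lebesgue_cV_step set0 = 0.
Proof. by rewrite /lebesgue_cV_step /pushforward preimage_set0 measure0. Qed.

Let step_ge0 A : 0 <= lebesgue_cV_step A.
Proof. by rewrite /lebesgue_cV_step /pushforward; exact: measure_ge0. Qed.

Let step_sigma_additive : semi_sigma_additive lebesgue_cV_step.
Proof.
move=> F mF tF mUF; rewrite /lebesgue_cV_step /pushforward preimage_bigcup.
apply: measure_semi_sigma_additive.
- by move=> k; rewrite -[X in measurable X]setTI; exact: measurable_cV_cons.
- apply/trivIsetP => /= i j _ _ ij; rewrite -preimage_setI.
  by move/trivIsetP : tF => /(_ _ _ _ _ ij) ->//; rewrite preimage_set0.
- by rewrite -preimage_bigcup -[X in measurable X]setTI;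
    exact: measurable_cV_cons.
Qed.

HB.instance Definition _ := isMeasure.Build _ _ _ lebesgue_cV_step
  step0 step_ge0 step_sigma_additive.

Let uncons (x : 'cV[R]_n.+1) : measurableTypeR R * 'cV[R]_n :=
  (x ord0 ord0, dsubmx (x : 'cV[R]_(1 + n))).

Let cV_consK : cancel (@cV_cons R n) uncons.
Proof.
move=> [a x]; rewrite /uncons /cV_cons/= col_mxKd; congr pair.
have -> : ord0 = lshift n (ord0 : 'I_1) :> 'I_n.+1 by apply/val_inj.
by apply: etrans (col_mxEu _ _ _ _) _; rewrite mxE eqxx.
Qed.

Let measurable_uncons : measurable_fun [set: 'cV[R]_n.+1] uncons.
Proof.
apply: measurable_fun_pair; first exact: measurable_cV_coord.
apply: measurable_fun_cV => i; under eq_fun do rewrite mxE.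
exact: measurable_cV_coord.
Qed.

Let step_sigma_finite : sigma_finite setT lebesgue_cV_step.
Proof.
have /sigma_finiteP[F [TF ndF Foo]] := sigma_finiteT (@lebesgue_measure R).
have /sigma_finiteP[G [TG ndG Goo]] := sigma_finiteT m.
exists (fun k => uncons @^-1` (F k `*` G k)).
  apply/seteqP; split=> // x _.
  have [i _ Fi] : (\bigcup_i F i) (uncons x).1 by rewrite -TF.
  have [j _ Gj] : (\bigcup_j G j) (uncons x).2 by rewrite -TG.
  exists (maxn i j) => //; split.
    by move: Fi; apply/subsetPset/ndF/leq_maxl.
  by move: Gj; apply/subsetPset/ndG/leq_maxr.
move=> k; have [mF Fk] := Foo k; have [mG Gk] := Goo k.
split.
  rewrite -[X in measurable X]setTI.
  by apply: measurable_uncons => //; exact: measurableX.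
rewrite /lebesgue_cV_step /pushforward -comp_preimage.
have -> : uncons \o @cV_cons R n = id by apply/funext; exact: cV_consK.
rewrite preimage_id.
by rewrite product_measure1E// lte_mul_pinfty// ge0_fin_numE.
Qed.

HB.instance Definition _ := Measure_isSigmaFinite.Build _ _ _ lebesgue_cV_step
  step_sigma_finite.

End lebesgue_cV_step.

(* Lebesgue measure on the Borel sets of R^n: the n-fold product of           *)
(* lebesgue_measure, transported to column vectors.                           *)
Fixpoint lebesgue_cV (R : realType) (n : nat) :
    {sigma_finite_measure set 'cV[R]_n -> \bar R} :=
  if n is n'.+1 then lebesgue_cV_step (lebesgue_cV R n') else \d_(0 : 'cV[R]_0).

Section sphere.
Context {R : realType} {n : nat}.
Implicit Types (x y t : 'cV[R]_n) (A : set 'cV[R]_n).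

Definition dot x y : R := (x^T *m y) ord0 ord0.

Definition enorm x : R := Num.sqrt (dot x x).

Definition unit_sphere : set 'cV[R]_n := [set t | enorm t = 1].

Definition sphere_cone A : set 'cV[R]_n :=
  [set r *: t | r in [set r : R | 0 < r <= 1] & t in A `&` unit_sphere].

Lemma dotE x y : dot x y = \sum_i x i ord0 * y i ord0.
Proof. by rewrite /dot mxE; apply: eq_bigr => i _; rewrite mxE. Qed.

Lemma enormZ (r : R) x : 0 <= r -> enorm (r *: x) = r * enorm x.
Proof.
move=> r0; rewrite /enorm !dotE.
under eq_bigr do rewrite !mxE mulrACA.
by rewrite -mulr_sumr -expr2 sqrtrM ?sqr_ge0// sqrtr_sqr ger0_norm.
Qed.

Lemma measurable_enorm : measurable_fun [set: 'cV[R]_n] enorm.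
Proof.
rewrite /enorm; apply: (measurableT_comp (continuous_measurable_fun (@sqrt_continuous R))).
under eq_fun do rewrite dotE.
apply: measurable_sum => i.
by apply: measurable_funM; exact: measurable_cV_coord.
Qed.

Lemma sphere_coneE A : sphere_cone A =
  (enorm @^-1` `]0, 1]) `&` ((fun x => (enorm x)^-1 *: x) @^-1` A).
Proof.
apply/seteqP; split => [_ [r /andP[r0 r1] [t [At St] <-]]|x []] /=.
  rewrite enormZ ?ltW// [enorm t]St mulr1 in_itv/= r0 r1; split => //.
  by rewrite scalerA mulVf ?gt_eqF// scale1r.
rewrite /= in_itv/= => /andP[x0 x1] Ax; exists (enorm x); first exact/andP.
exists ((enorm x)^-1 *: x); last by rewrite scalerA divff ?gt_eqF// scale1r.
by split => //; rewrite /unit_sphere/= enormZ ?invr_ge0 ?ltW// mulVf// gt_eqF.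
Qed.

Lemma measurable_sphere_cone A : measurable A -> measurable (sphere_cone A).
Proof.
move=> mA; rewrite sphere_coneE; apply: measurableI.
  rewrite -[X in measurable X]setTI; apply: measurable_enorm => //.
rewrite -[X in measurable X]setTI.
suff: measurable_fun setT (fun x => (enorm x)^-1 *: x) by exact.
apply: measurable_fun_cV => i; under eq_fun do rewrite mxE.
apply: measurable_funM; last exact: measurable_cV_coord.
under eq_fun do rewrite -powR_inv1 ?sqrtr_ge0//.
exact: (measurableT_comp (measurable_powR (-1)) measurable_enorm).
Qed.

End sphere.

(* The (n-1)-dimensional area of a part A of the unit sphere of R^n is n      *)
(* times the volume of the cone { r t | 0 < r <= 1, t in A }, since           *)
(* dx = r^(n-1) dr dt in polar coordinates.                                   *)
Definition surface_borel (R : realType) (n : nat) (A : set 'cV[R]_n) :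
  \bar R := (n%:R%:E * lebesgue_cV R n (sphere_cone A))%E.

Section surface_measure.
Context {R : realType} {n : nat}.
Local Open Scope ereal_scope.

Let mu := @surface_borel R n.

Let mu0 : mu set0 = 0.
Proof.
rewrite /mu /surface_borel (_ : sphere_cone _ = set0) ?measure0 ?mule0//.
by rewrite sphere_coneE preimage_set0 setI0.
Qed.

Let mu_ge0 A : 0 <= mu A.
Proof. by rewrite mule_ge0// lee_fin. Qed.

Let mu_sigma_additive : semi_sigma_additive mu.
Proof.
move=> F mF tF mUF.
have coneU : sphere_cone (\bigcup_k F k) = \bigcup_k sphere_cone (F k).
  by rewrite sphere_coneE preimage_bigcup setI_bigcupr; apply: eq_bigcupr => k _;
    rewrite sphere_coneE.
rewrite /mu /surface_borel coneU.
have := @measure_semi_sigma_additive _ _ _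
  (mscale (NngNum (ler0n R n)) (lebesgue_cV R n)) (sphere_cone \o F).
apply.
- by move=> k; exact: measurable_sphere_cone.
- apply/trivIsetP => /= i j _ _ ij; rewrite !sphere_coneE setIACA.
  move/trivIsetP : tF => /(_ _ _ I I ij) FF0.
  by rewrite -(preimage_setI _ (F i)) FF0 preimage_set0 setI0.
- by rewrite /comp -coneU; exact: measurable_sphere_cone.
Qed.

HB.instance Definition _ := isMeasure.Build _ _ _ (@surface_borel R n)
  mu0 mu_ge0 mu_sigma_additive.

End surface_measure.

(* The completion, so that measurability on the sphere is Lebesgue            *)
(* measurability.                                                             *)
Definition surface_measure (R : realType) (n : nat) :=
  @completed_measure_extension _ _ _ (@surface_borel R n).

Arguments surface_measure R n : clear implicits.

HB.instance Definition _ (R : realType) (n : nat) :=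
  Measure.on (@surface_measure R n).

Definition nu_density (R : realType) (n l : nat) (s : R) : R :=
  s `^ (l%:R / 2 - 1) * (1 - s) `^ ((n - l)%:R / 2 - 1).

(* On the Lebesgue-measurable sets of R; the values of powR at the endpoints  *)
(* of [0, 1] are immaterial.                                                  *)
Definition nu (R : realType) (n l : nat) :
    set (caratheodory_type (@wlength R idfun)^*%mu) -> \bar R := fun A =>
  (\int[@completed_lebesgue_measure R]_(s in A `&` `[0%R, 1%R])
     (nu_density n l s)%:E)%E.
Arguments nu R n l : clear implicits.

Section nu_measure.
Context {R : realType}.
Variables n l : nat.
Local Open Scope ereal_scope.

Let cara_measurable (A : set R) : measurable A ->
  ((@wlength R idfun)^*%mu).-cara.-measurable A.
Proof. exact: sub_caratheodory. Qed.

Let measurable_density D : measurable_fun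
  (D : set (caratheodory_type (@wlength R idfun)^*%mu))
  (fun s => (@nu_density R n l s)%:E).
Proof.
apply: measurable_funTS => _ B mB; apply: cara_measurable.
have : measurable_fun [set: R] (fun s => (@nu_density R n l s)%:E); last exact.
apply/measurable_EFinP; apply: measurable_funM; first exact: measurable_powR.
apply: (measurableT_comp (measurable_powR _)).
exact: measurable_funB.
Qed.

Let density_ge0 s : 0 <= (@nu_density R n l s)%:E.
Proof. by rewrite lee_fin mulr_ge0// powR_ge0. Qed.

Let nu0 : nu R n l set0 = 0.
Proof. by rewrite /nu set0I integral_set0. Qed.

Let nu_ge0 A : 0 <= nu R n l A.
Proof. by apply: integral_ge0 => s _. Qed.

Let nu_sigma_additive : semi_sigma_additive (nu R n l).
Proof.
move=> F mF tF mUF; rewrite /nu setI_bigcupl ge0_integral_bigcup//=.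
- apply: is_cvg_ereal_nneg_natsum_cond => k _ _.
  by apply: integral_ge0 => s _.
- by move=> k; apply: measurableI => //; exact: cara_measurable.
- exact: trivIset_setIr.
Qed.

HB.instance Definition _ := isMeasure.Build _ _ _ (nu R n l)
  nu0 nu_ge0 nu_sigma_additive.

End nu_measure.

Definition Gamma (R : realType) (a : R) : R :=
  \int[@lebesgue_measure R]_(t in `]0%R, +oo[) (t `^ (a - 1) * expR (- t)).

(* The area of the unit sphere S^d of R^(d+1). *)
Definition sigma (R : realType) (d : nat) : R :=
  2 * pi `^ (d.+1%:R / 2) / Gamma (d.+1%:R / 2).

Arguments sigma R d : clear implicits.

Definition orthogonal_mx (R : realType) (k : nat) : set 'M[R]_k :=
  [set a | a^T *m a = 1%:M].

Definition K_group (R : realType) (n l : nat) : set 'M[R]_n :=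
  [set g | exists (e : (n - l + l)%N = n) (a : 'M[R]_(n - l)) (b : 'M[R]_l),
    [/\ orthogonal_mx a, orthogonal_mx b &
        g = castmx (e, e) (block_mx a 0 0 b)]].

Definition K_invariant (R : realType) (n l : nat) (f : 'cV[R]_n -> R) : Prop :=
  forall g t, K_group l g -> unit_sphere t -> f (g *m t) = f t.

(* The last l coordinates. *)
Definition coord_subspace (R : realType) (n l : nat) : set 'cV[R]_n :=
  [set v | forall i : 'I_n, (i < n - l)%N -> v i ord0 = 0].

Definition Pr (R : realType) (n l : nat) : 'M[R]_n :=
  \matrix_(i, j) ((i == j) && (n - l <= i)%N)%:R.

Arguments Pr R n l : clear implicits.

Definition sparam (R : realType) (n l : nat) (t : 'cV[R]_n) : R :=
  (t^T *m Pr R n l *m t) ord0 ord0.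

Definition angle (R : realType) (n : nat) (t : 'cV[R]_n) (V : set 'cV[R]_n) :
  R := inf [set acos (dot t v) | v in V `&` unit_sphere].

(* Main.v *)
From HB Require Import structures.
Require Import Defs.
From mathcomp Require Import all_boot all_order all_algebra.
From mathcomp Require Import all_classical all_reals all_analysis.
From mathcomp Require Import measurable_realfun ring lra.
Import Order.TTheory GRing.Theory Num.Theory.
Import numFieldNormedType.Exports.

Local Open Scope classical_set_scope.
Local Open Scope ring_scope.

(** Put m = n - l and write a vector of R^n as z = (x, y) with x in R^m and y in
    R^l, so that s = |y|^2 on the unit sphere.

    _Invariance._ The group acts on x and y by independent orthogonal matrices,
    and a Householder reflection carries any vector to any other one of the same
    length. As |x|^2 = 1 - s on the sphere, the orbits are exactly the level sets
    of s ([K_orbit_representative]): an invariant function is a function of s.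

    _Integration._ The area of a part of the sphere is n times the volume of the
    cone over it, so that the image of the surface measure by s is a matter of
    volumes. By Tonelli and polar coordinates in both factors
    ([integral_enorm]) the volume of a cone becomes a double integral in p = |x|
    and q = |y| with weights p^(m-1) and q^(l-1). In the variables p and t = q / p
    the p-integral is elementary ([integral_slope]), and s = t^2 / (1 + t^2) turns
    what remains into an integral against nu ([surface_borel_sparam]). The
    constants sigma come from the Gaussian integral, computed coordinatewise and
    in polar coordinates ([sigma_ball_volume]). The form in omega is the
    substitution s = cos^2 omega ([integral_angle]).

    _Measurability._ The functions are measurable for completed measures only.
    Pulling back by s is harmless, since a set that is null for nu pulls back to
    a set of area zero ([sparam_completed]). That f0 is measurable when f is so
    needs the converse: a set A is Lebesgue measurable as soon as its preimage by
    s is measurable on the sphere. The preimage lies between two Borel sets that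
    differ by a set of area zero, and the infinite cone over this set has volume
    zero. By Tonelli almost every ray t |-> (x, t y) meets this cone at a null
    set of times only ([exists_null_ray]). Since s runs through ]0, 1[ along such
    a ray, restriction to it puts A between two Borel sets of the line that
    differ by a null set ([sparam_completed_converse]).

    _Angle._ The scalar products of theta = (x, y) with the unit vectors of R^l
    are at most |y|, with equality in the direction of y ([cos_angle]). *)

Set Implicit Arguments.
Unset Strict Implicit.
Unset Printing Implicit Defensive.

(** * Transport of integrals and change of variable on the line *)

Section pushdens.
Import HBNNSimple.

(** Agreement of a measure with the image by [phi] of a density is needed on
    sets only: simple functions and monotone convergence do the rest. Stated
    over arbitrary measurable types, it serves for image measures, for densities
    and for changes of variable alike, on Borel sets and on completed
    sigma-algebras. *)
Lemma ge0_integral_pushdens d1 d2 (X : measurableType d1) (Y : measurableType d2)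
    (R : realType) (mu : {measure set X -> \bar R})
    (nu : {measure set Y -> \bar R}) (phi : X -> Y) (h : X -> R)
    (D : set X) (E : set Y) (g : Y -> \bar R) :
  measurable D -> measurable E -> measurable_fun D phi ->
  measurable_fun D h -> (forall x, D x -> 0 <= h x) ->
  (forall x, D x -> E (phi x)) ->
  (forall A, measurable A -> A `<=` E ->
    nu A = (\int[mu]_(x in D `&` phi @^-1` A) (h x)%:E)%E) ->
  measurable_fun E g -> (forall y, E y -> (0 <= g y)%E) ->
  (\int[nu]_(y in E) g y = \int[mu]_(x in D) (g (phi x) * (h x)%:E))%E.
Proof.
move=> mD mE mphi mh h0 DE nuE mg g0; pose f_ := nnsfun_approx mE mg.
have mfphi n : measurable_fun D (fun x => f_ n (phi x)).
  apply: (@measurable_comp _ _ _ _ _ _ setT (f_ n)) => //.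
transitivity (limn (fun n => \int[nu]_(x in E) (f_ n x)%:E)%E).
  rewrite -monotone_convergence//.
  - apply: eq_integral => y /[!inE] yD; apply/esym/cvg_lim => //.
    by apply: cvg_nnsfun_approx.
  - by move=> n; exact/measurable_EFinP/measurable_funTS.
  - by move=> n y _; rewrite lee_fin.
  - by move=> y _ m n mn; rewrite lee_fin; exact/lefP/nd_nnsfun_approx.
transitivity (limn (fun n => \int[mu]_(x in D) ((f_ n (phi x))%:E * (h x)%:E)%E)%E);
    last first.
  rewrite -monotone_convergence//.
  - apply: eq_integral => x /[!inE] xD; apply/cvg_lim => //.
    apply: cvgeZr => //; apply: cvg_nnsfun_approx => //; exact: DE.
  - move=> n; apply: emeasurable_funM; exact/measurable_EFinP.
  - by move=> n x Dx; rewrite mule_ge0// lee_fin// h0.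
  - move=> x Dx m n mn; rewrite lee_wpmul2r ?lee_fin ?h0//.
    exact/lefP/nd_nnsfun_approx.
congr (limn _); apply/funext => n.
transitivity (\sum_(k \in range (f_ n)) (k%:E * nu (E `&` f_ n @^-1` [set k])))%E.
  under eq_integral do rewrite fimfunE -fsumEFin//.
  rewrite ge0_integral_fsum//; last 2 first.
  - by move=> r; exact/measurable_EFinP/measurable_funTS/measurable_funM.
  - by move=> r x _; rewrite nnfun_muleindic_ge0.
  apply: eq_fsbigr => r _.
  rewrite (integralZl_indic_nnsfun)//.
  by rewrite integral_indic// setIC.
have mfk r : measurable (D `&` phi @^-1` (f_ n @^-1` [set r])).
  by apply: mphi.
transitivity (\int[mu]_(x in D) (\sum_(k \in range (f_ n))
    ((k * \1_(f_ n @^-1` [set k]) (phi x) * h x)%:E)))%E; last first.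
  apply: eq_integral => x /[!inE] Dx.
  rewrite (fimfunE (f_ n)) -EFinM fsumEFin//; congr EFin.
  rewrite mulrC mulr_fsumr; apply: eq_fsbigr => r _.
  by rewrite mulrC.
have mind r : measurable_fun D (fun x => r * \1_(f_ n @^-1` [set r]) (phi x) * h x).
  apply: measurable_funM => //; apply: measurable_funM => //.
  exact: (measurableT_comp (measurable_indic _) mphi).
rewrite ge0_integral_fsum//; last 2 first.
- by move=> r; exact/measurable_EFinP.
- move=> r x Dx; rewrite EFinM mule_ge0// ?lee_fin ?h0//.
  by have := nnfun_muleindic_ge0 (f_ n) r (phi x); rewrite lee_fin.
apply: eq_fsbigr => r; rewrite inE => -[y _ fyr].
have r0 : 0 <= r by rewrite -fyr.
transitivity (r%:E * \int[mu]_(x in D)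
  ((\1_(f_ n @^-1` [set r]) (phi x) * h x)%:E))%E; last first.
  rewrite -ge0_integralZl//.
  - by apply: eq_integral => x _; rewrite -EFinM mulrA.
  - apply/measurable_EFinP; apply: measurable_funM => //.
    exact: (measurableT_comp (measurable_indic _) mphi).
  - by move=> x Dx; rewrite lee_fin mulr_ge0// ?h0// indicE.
congr (_ * _)%E.
rewrite nuE; [|exact: measurableI|exact: subIsetl].
rewrite [RHS](_ : _ = \int[mu]_(x in D)
  (((EFin \o h) \_ (phi @^-1` (f_ n @^-1` [set r]))) x))%E; last first.
  apply: eq_integral => x _; rewrite patchE indicE.
  have -> : (x \in phi @^-1` (f_ n @^-1` [set r])) = (phi x \in f_ n @^-1` [set r]).
    by apply/idP/idP; rewrite !inE.
  by case: ifPn; rewrite ?mul1r ?mul0r.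
rewrite -integral_mkcondr; congr integral.
apply/seteqP; split => x /= [Dx]; last by move=> ?; split => //; split => //; exact: DE.
by move=> [].
Qed.

End pushdens.

(** The right-hand side is a measure in [A] and the rays are stable under
    intersection and generate the Borel sets. *)
Lemma pushdens_rays d (X : measurableType d) (R : realType)
    (mu : {measure set X -> \bar R}) (phi : X -> R) (h : X -> R) (D : set X)
    (m : {measure set (measurableTypeR R) -> \bar R}) :
  measurable D -> measurable_fun D phi ->
  measurable_fun D h -> (forall x, D x -> 0 <= h x) ->
  (forall a, (m `]-oo, a]%classic < +oo)%E) ->
  (forall a, m `]-oo, a]%classic =
    (\int[mu]_(x in D `&` phi @^-1` `]-oo, a]%classic) (h x)%:E)%E) ->
  forall A, measurable A ->
    m A = (\int[mu]_(x in D `&` phi @^-1` A) (h x)%:E)%E.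
Proof.
move=> mD mphi mh h0 moo mE.
pose k (A : set (measurableTypeR R)) :=
  (\int[mu]_(x in D `&` phi @^-1` A) (h x)%:E)%E.
have k0 : k set0 = 0%E by rewrite /k preimage_set0 setI0 integral_set0.
have kge0 A : (0 <= k A)%E.
  by apply: integral_ge0 => x [Dx _]; rewrite lee_fin h0.
have ksa : semi_sigma_additive k.
  move=> F mF tF mUF; rewrite /k preimage_bigcup setI_bigcupr.
  rewrite ge0_integral_bigcup//=.
  - by apply: is_cvg_ereal_nneg_natsum_cond => n _ _; exact: kge0.
  - by move=> n; apply: mphi => //; exact: mF.
  - rewrite -setI_bigcupr; apply/measurable_EFinP.
    by apply: (measurable_funS mD _ mh); exact: subIsetl.
  - by move=> x [n _ [Dx _]]; rewrite lee_fin h0.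
  - apply: trivIset_setIl; apply/trivIsetP => i j _ _ ij.
    move/trivIsetP : tF => /(_ i j I I ij).
    by rewrite -preimage_setI => ->; rewrite preimage_set0.
pose K : {measure set (measurableTypeR R) -> \bar R} :=
  HB.pack k (isMeasure.Build _ _ _ k k0 kge0 ksa).
move=> A mA; rewrite -/(k A) -[k A]/(K A).
apply: (@measure_unique _ R (measurableTypeR R)
   [set `]-oo, a]%classic | a in [set: R]]
   (fun n => `]-oo, n%:R]%classic) _ _ _ _ m K _ _ A) => //.
- rewrite [LHS](RGenOInfty.measurableE R); apply/seteqP; split.
    apply: smallest_sub; first exact: smallest_sigma_algebra.
    move=> _ [x ->]; rewrite -setCitvl.
    apply: sigma_algebraC.
    by apply: sub_sigma_algebra; exists x.
  apply: smallest_sub; first exact: smallest_sigma_algebra.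
  move=> _ [x _ <-]; rewrite -setCitvr.
  apply: sigma_algebraC.
  by apply: sub_sigma_algebra; exists x.
- move=> _ _ [a _ <-] [b _ <-]; exists (Num.min a b) => //.
  by apply/seteqP; split => x /=; rewrite !in_itv/= le_min => /andP.
- apply/seteqP; split => // x _; exists (Num.truncn x).+1 => //=.
  by rewrite in_itv/= ltW// truncnS_gt.
- by move=> _ [a _ <-]; exact: mE.
Qed.

Lemma derivable_itv (R : realType) (G g : R -> R) (a b : R) :
  (forall x : R, is_derive x (1 : R) G (g x)) -> derivable_oo_LRcontinuous G a b.
Proof.
move=> dG; have cG x : {for x, continuous G}.
  by apply: differentiable_continuous; apply/derivable1_diffP; exact: ex_derive.
split => //; apply: cvg_at_right_filter || apply: cvg_at_left_filter; exact: cG.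
Qed.

Lemma is_derive_continuous (R : realType) (G g : R -> R) :
  (forall x : R, is_derive x (1 : R) G (g x)) -> continuous G.
Proof.
move=> dG x.
by apply: differentiable_continuous; apply/derivable1_diffP; exact: ex_derive.
Qed.

Lemma FTC_ge0 (R : realType) (G g : R -> R) (a b : R) : a <= b ->
  (forall x : R, is_derive x (1 : R) G (g x)) -> continuous g ->
  (\int[@lebesgue_measure R]_(x in `[a, b]) (g x)%:E = (G b - G a)%:E)%E.
Proof.
move=> ab dG cg; move: ab; rewrite le_eqVlt => /predU1P[<-|ab].
  by rewrite set_itv1 integral_set1 subrr.
rewrite (continuous_FTC2 ab _ (derivable_itv _ _ dG)) ?EFinB//.
- exact: continuous_subspaceT.
- by move=> x _; rewrite derive1E; apply: derive_val.
Qed.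

(** By uniqueness it is enough to look at a ray, whose trace on [G a, G b] is
    pulled back by the increasing function [G] to a segment [a, c]; there the
    formula is the fundamental theorem of calculus. *)
Lemma subst_segment (R : realType) (G g : R -> R) (a b : R) : a <= b ->
  (forall x : R, is_derive x (1 : R) G (g x)) -> continuous g ->
  (forall x, a <= x <= b -> 0 <= g x) -> (forall x, a < x < b -> 0 < g x) ->
  forall A : set R, measurable A ->
    lebesgue_measure (A `&` `[G a, G b]) =
    (\int[@lebesgue_measure R]_(x in `[a, b] `&` G @^-1` A) (g x)%:E)%E.
Proof.
move=> ab dG cg g0 gp.
have cG := is_derive_continuous dG.
have G_lt x y : a <= x -> x < y -> y <= b -> G x < G y.
  move=> ax xy yb; apply: (gtr0_derive1_incr _ _ _ ax xy yb).
  - by move=> z _.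
  - by move=> z; rewrite in_itv/= derive1E derive_val => /gp.
  - exact: continuous_subspaceT.
have G_le x y : a <= x -> x <= y -> y <= b -> G x <= G y.
  by move=> ax; rewrite le_eqVlt => /predU1P[-> //|xy yb]; exact/ltW/G_lt.
have mab : measurable (`[G a, G b]%classic : set (measurableTypeR R)) by [].
have mg : measurable_fun [set: R] g by exact: continuous_measurable_fun.
have mG : measurable_fun [set: R] G by exact: continuous_measurable_fun.
have key v : lebesgue_measure (`]-oo, v]%classic `&` `[G a, G b]%classic) =
    (\int[@lebesgue_measure R]_(x in `[a, b] `&` G @^-1` `]-oo, v]%classic) (g x)%:E)%E.
  have [vG|Gv] := ltP v (G a).
    rewrite (_ : `]-oo, v]%classic `&` `[G a, G b]%classic = set0) ?measure0;
      last first.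
      apply/seteqP; split => // x []; rewrite /= !in_itv/= => xv /andP[Gx _].
      by have := le_lt_trans (le_trans Gx xv) vG; rewrite ltxx.
    rewrite (_ : `[a, b]%classic `&` _ = set0) ?integral_set0//.
    apply/seteqP; split => // x []; rewrite /= !in_itv/= => /andP[ax xb] Gxv.
    by have := le_lt_trans (le_trans (G_le _ _ (lexx _) ax xb) Gxv) vG; rewrite ltxx.
  have Gab : G a <= G b by exact: G_le.
  (* the minimum covers the rays that contain the whole segment *)
  have [c /[!in_itv]/= /andP[ac cb] Gc] : exists2 c, c \in `[a, b] & G c =
    Num.min v (G b).
    apply: IVT => //; first exact: continuous_subspaceT.
    by rewrite (min_idPl Gab) (max_idPr Gab) le_min Gv Gab ge_min lexx orbT.
  rewrite (_ : `]-oo, v]%classic `&` `[G a, G b]%classic = `[G a, G c]%classic);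
    last first.
    apply/seteqP; split => x /=; rewrite !in_itv/= Gc le_min.
      by move=> [-> /andP[-> ->]].
    by move=> /and3P[-> -> ->].
  rewrite (_ : `[a, b]%classic `&` _ = `[a, c]%classic); last first.
    apply/seteqP; split => x /=; rewrite !in_itv/=.
      move=> [/andP[ax xb] Gxv]; rewrite ax /= leNgt; apply/negP => cx.
      by have := G_lt _ _ ac cx xb; rewrite Gc ltNge le_min Gxv G_le.
    move=> /andP[ax xc]; rewrite ax (le_trans xc cb); split => //.
    by have := G_le _ _ ax xc cb; rewrite Gc le_min => /andP[].
  rewrite (FTC_ge0 ac dG cg) lebesgue_measure_itv/= lte_fin EFinB.
  have := G_le _ _ (lexx a) ac cb; rewrite le_eqVlt => /predU1P[->|->//].
  by rewrite ltxx subee.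
move=> A mA.
apply: (@pushdens_rays _ _ R lebesgue_measure G g `[a,
  b]%classic (mrestr lebesgue_measure mab)) => //.
- exact: measurable_funS mG.
- exact: measurable_funS mg.
- move=> v; apply: (@le_lt_trans _ _ (lebesgue_measure `[G a, G b]%classic)).
    rewrite /mrestr; apply: le_measure; rewrite ?inE//.
    by apply: measurableI.
  by rewrite lebesgue_measure_itv; case: ifP; rewrite ?ltry.
Qed.

(** Exhaustion of the half-line by the segments [0, k]. *)
Lemma subst_halfline (R : realType) (G g : R -> R) (J : set R) :
  (forall x : R, is_derive x (1 : R) G (g x)) -> continuous g ->
  (forall x, 0 <= x -> 0 <= g x) -> (forall x, 0 < x -> 0 < g x) ->
  J = \bigcup_k `[G 0, G k%:R]%classic ->
  forall A : set R, measurable A ->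
    lebesgue_measure (A `&` J) =
    (\int[@lebesgue_measure R]_(x in `[0%R, +oo[ `&` G @^-1` A) (g x)%:E)%E.
Proof.
move=> dG cg g0 gp JE A mA.
have cG := is_derive_continuous dG.
have mG : measurable_fun [set: R] G by exact: continuous_measurable_fun.
have mg : measurable_fun [set: R] g by exact: continuous_measurable_fun.
have mGA : measurable (G @^-1` A) by rewrite -[X in measurable X]setTI; exact: mG.
have G_lt x y : 0 <= x -> x < y -> G x < G y.
  move=> ax xy; apply: (@gtr0_derive1_incr _ G x y) => //.
  - by move=> z; rewrite in_itv/= derive1E derive_val => /andP[xz _];
    apply/gp/le_lt_trans/xz.
  - exact: continuous_subspaceT.
have seg k : lebesgue_measure (A `&` `[G 0, G k%:R]) =
    (\int[@lebesgue_measure R]_(x in `[0%R, k%:R] `&` G @^-1` A) (g x)%:E)%E.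
  by apply: subst_segment => // x /andP[? _]; [exact: g0|exact: gp].
have ndJ : {homo (fun k => A `&` `[G 0, G k%:R]%classic) : n m / (n <= m)%N >->
  (n <= m)%O}.
  move=> i j ij; apply/subsetPset => x [Ax] /=; rewrite !in_itv/= => /andP[-> xi];
    split => //=.
  rewrite (le_trans xi)//; move: ij; rewrite leq_eqVlt => /predU1P[->//|ij].
  by apply/ltW/G_lt => //; rewrite ltr_nat.
have L1 : lebesgue_measure (A `&` `[G 0, G k%:R]) @[k --> \oo] -->
  lebesgue_measure (A `&` J).
  rewrite JE setI_bigcupr; apply: nondecreasing_cvg_mu => //.
  - by move=> k; exact: measurableI.
  - by apply: bigcup_measurable => k _; exact: measurableI.
have L2 : (\int[@lebesgue_measure R]_(x in `[0%R, k%:R] `&` G @^-1` A) (g x)%:E)%E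
    @[k --> \oo] --> (\int[@lebesgue_measure R]_(x in `[0%R, +oo[ `&` G @^-1` A)
      (g x)%:E)%E.
  rewrite (_ : `[0, +oo[%classic = \bigcup_k `[0, k%:R]%classic); last first.
    apply/seteqP; split => x /=; last by move=> [k _] /=;
      rewrite !in_itv/= => /andP[->].
    rewrite in_itv/= andbT => x0; exists (Num.truncn x).+1 => //=.
    by rewrite in_itv/= x0 ltW// truncnS_gt.
  rewrite setI_bigcupl; apply: ge0_nondecreasing_set_cvg_integral => //.
  - move=> i j ij; apply/subsetPset; apply: setSI => x /=.
    by rewrite !in_itv/= => /andP[-> xi]; rewrite (le_trans xi)// ler_nat.
  - by move=> k; exact: measurableI.
  - by move=> k; apply/measurable_EFinP; exact: measurable_funS mg.
  - by move=> k x [/=]; rewrite in_itv/= lee_fin => /andP[? _] _; exact: g0.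
rewrite (eq_cvg _ _ seg) in L1.
by apply: (cvg_unique _ L1 L2).
Qed.

Lemma lebesgue_measure_scale (R : realType) (r : R) (A : set R) : 0 < r ->
  measurable A ->
  lebesgue_measure ((fun x => r * x) @^-1` A) = (r^-1%:E * lebesgue_measure A)%E.
Proof.
move=> r0 mA.
have mr : measurable_fun [set: measurableTypeR R] (fun x : R => r * x :
  measurableTypeR R).
  by apply: measurable_funM.
rewrite (@lebesgue_measure_unique R
  (mscale (NngNum (ltW r0)) (pushforward lebesgue_measure (fun x : R => r * x :
    measurableTypeR R))) _ A mA)/=; last first.
  move=> _ [[a b]] _ <-.
  rewrite /mscale/= /pushforward.
  rewrite (_ : _ @^-1` _ = `](r^-1 * a), (r^-1 * b)]%classic); last first.
    apply/seteqP; split => x /=; rewrite !in_itv/=;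
    by rewrite ltr_pdivrMl// ler_pdivlMl.
  rewrite !lebesgue_measure_itv/= !lte_fin ltr_pM2l ?invr_gt0//.
  case: ifPn => _; last by rewrite mule0.
  by rewrite -!EFinB -EFinM -mulrBr mulVKf// gt_eqF.
by rewrite /mscale/= /pushforward muleA -EFinM mulVf ?mul1e// gt_eqF.
Qed.

Lemma ge0_integral_scale (R : realType) (r : R) (g : R -> \bar R) : 0 < r ->
  measurable_fun [set: R] g -> (forall x, (0 <= g x)%E) ->
  (\int[@lebesgue_measure R]_x g (r * x)%R =
   r^-1%:E * \int[@lebesgue_measure R]_x g x)%E.
Proof.
move=> r0 mg g0.
have mr : measurable_fun [set: R] (fun x : R => r * x) by apply: measurable_funM.
have mgr : measurable_fun [set: R] (fun x => g (r * x))
  by exact: (measurableT_comp mg mr).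
rewrite (@ge0_integral_pushdens _ _ _ _ _ lebesgue_measure lebesgue_measure
  (fun x => r * x) (cst r) setT setT g)//.
- rewrite -ge0_integralZl ?lee_fin ?invr_ge0 ?(ltW r0)//.
  + apply: eq_integral => x _ /=; rewrite muleCA -EFinM mulVf ?gt_eqF// mule1.
    by [].
  + apply: emeasurable_funM; first exact: mgr.
    by apply/measurable_EFinP; exact: measurable_cst.
  + by move=> x _; rewrite mule_ge0// lee_fin ltW.
- by move=> x _; rewrite ltW.
- move=> A mA _; rewrite setTI (eq_integral (cst r%:E))// integral_cst//=; last first.
    by rewrite -[X in measurable X]setTI; exact: mr.
  by rewrite lebesgue_measure_scale// muleA -EFinM divff ?mul1e// gt_eqF.
Qed.

Lemma is_derive_sqr (R : realType) (t : R) :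
  is_derive t (1 : R) (fun t : R => t ^+ 2) (2 * t).
Proof.
have := @is_deriveX _ _ (@idfun R^o) 2 t (1 : R) 1 (is_derive_id _ _).
by rewrite [_ *: _]mulr1 /= expr1 exprfctE.
Qed.

Lemma is_derive_sqr_ratio (R : realType) (t : R) :
  is_derive t (1 : R) (fun t : R => 1 - (1 + t ^+ 2)^-1) (2 * t / (1 + t ^+ 2) ^+ 2).
Proof.
have t0 : 1 + t ^+ 2 != 0 by rewrite gt_eqF// ltr_wpDr ?sqr_ge0.
have d2 : is_derive t (1 : R) (fun t : R => 1 + t ^+ 2) (2 * t).
  by rewrite -[2 * t]add0r; apply: is_deriveD; exact: is_derive_sqr.
have dV : is_derive t (1 : R) (fun t : R => (1 + t ^+ 2)^-1)
  (- (1 + t ^+ 2) ^- 2 * (2 * t)).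
  apply: DeriveDef; first by apply: derivableV => //; exact: ex_derive.
  by rewrite deriveV ?derive_val//; exact: ex_derive.
have := is_deriveB (is_derive_cst (1 : R) t (1 : R)) dV.
by rewrite sub0r mulNr opprK mulrC.
Qed.

(** The substitution s = t^2 / (1 + t^2) is written 1 - 1 / (1 + t^2), which
    makes its derivative and monotonicity immediate; with r the square root of
    1 + t^2, both s and 1 - s are squares, so that their half-integral powers
    become integral powers. *)
Lemma sqr_ratio_sqrt (R : realType) (t : R) : let r := Num.sqrt (1 + t ^+ 2) in
  [/\ 0 < r, 1 - (1 - (1 + t ^+ 2)^-1) = r^-1 ^+ 2 &
      1 - (1 + t ^+ 2)^-1 = (t / r) ^+ 2].
Proof.
have p1 : 0 < 1 + t ^+ 2 by rewrite ltr_wpDr ?sqr_ge0.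
move=> r; have r2 : 1 + t ^+ 2 = r ^+ 2 by rewrite sqr_sqrtr// ltW.
split; first by rewrite sqrtr_gt0.
- by rewrite r2 exprVn; ring.
- by rewrite expr_div_n -r2; field; rewrite gt_eqF.
Qed.

Lemma is_derive_sqr_cos (R : realType) (t : R) :
  is_derive t (1 : R) (fun t : R => - cos t ^+ 2) (2 * sin t * cos t).
Proof.
have := is_deriveN (@is_deriveX _ _ (@cos R) 2 t (1 : R) (- sin t) (is_derive_cos _)).
rewrite /= expr1 /GRing.scale/= mulrN opprK mulrAC.
by rewrite exprfctE.
Qed.

Lemma continuous_sqr (R : realType) : continuous (fun t : R => t ^+ 2).
Proof. exact: is_derive_continuous (@is_derive_sqr R). Qed.

Lemma subst_sqr_ratio (R : realType) (A : set R) : measurable A ->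
  lebesgue_measure (A `&` `[0%R, 1%R[) =
  (\int[@lebesgue_measure R]_(t in `[0%R,
    +oo[ `&` (fun t : R => 1 - (1 + t ^+ 2)^-1)%R @^-1` A)
     (2 * t / (1 + t ^+ 2) ^+ 2)%:E)%E.
Proof.
have p1 (t : R) : 0 < 1 + t ^+ 2 by rewrite ltr_wpDr ?sqr_ge0.
apply: subst_halfline.
- exact: is_derive_sqr_ratio.
- move=> t; apply: cvgM.
    by apply: cvgM; [exact: cvg_cst|exact: cvg_id].
  apply: cvgV; first by rewrite expf_neq0// gt_eqF.
  have c1 : (1 + x ^+ 2) @[x --> t] --> 1 + t ^+ 2.
    by apply: cvgD; [exact: cvg_cst|exact: continuous_sqr].
  exact: (cvg_comp _ _ c1 (@continuous_sqr R _)).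
- by move=> t t0; apply: divr_ge0; [exact: mulr_ge0|exact: sqr_ge0].
- by move=> t t0; apply: divr_gt0; [exact: mulr_gt0|exact: exprn_gt0].
rewrite expr0n addr0 invr1 subrr.
apply/seteqP; split => x /=.
  rewrite in_itv/= => /andP[x0 x1].
  (* x <= k^2 / (1 + k^2) as soon as 1 / (1 - x) <= k *)
  pose k := (Num.truncn (1 - x)^-1).+1.
  have kx : (1 - x)^-1 < k%:R by exact: truncnS_gt.
  exists k => //=; rewrite in_itv/= x0/= lerBrDr -lerBrDl.
  rewrite -[1 - x]invrK lef_pV2 ?posrE// ?invr_gt0 ?subr_gt0//.
  rewrite (le_trans (ltW kx))// (le_trans (_ : _ <= k%:R ^+ 2))//.
    by rewrite -natrX ler_nat -mulnn leq_pmulr.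
  by rewrite lerDr.
move=> [k _] /=; rewrite !in_itv/= => /andP[-> /le_lt_trans]; apply.
by rewrite gtrBl invr_gt0.
Qed.

Lemma subst_sqr (R : realType) (A : set R) : measurable A ->
  lebesgue_measure (A `&` `[0%R, +oo[) =
  (\int[@lebesgue_measure R]_(t in `[0%R, +oo[ `&` (fun t : R => t ^+ 2)%R @^-1` A)
     (2 * t)%:E)%E.
Proof.
apply: subst_halfline.
- exact: is_derive_sqr.
- by move=> t; apply: cvgM; [exact: cvg_cst|exact: cvg_id].
- by move=> t t0; rewrite mulr_ge0.
- by move=> t t0; rewrite mulr_gt0.
rewrite expr0n/=; apply/seteqP; split => x /=.
  rewrite in_itv/= andbT => x0; pose k := (Num.truncn x).+1.
  have kx : x < k%:R by exact: truncnS_gt.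
  exists k => //=; rewrite in_itv/= x0/= (le_trans (ltW kx))//.
  by rewrite -natrX ler_nat -mulnn leq_pmulr.
by move=> [k _] /=; rewrite !in_itv/= => /andP[->].
Qed.

(** As cos^2 decreases on [0, pi / 2], its opposite is substituted and Lebesgue
    measure is reflected. *)
Lemma subst_sqr_cos (R : realType) (A : set R) : measurable A ->
  lebesgue_measure (A `&` `[0%R, 1%R]) =
  (\int[@lebesgue_measure R]_(t in `[0%R, (pi / 2)%R] `&` (fun t : R => cos t ^+
    2)%R @^-1` A)
     (2 * sin t * cos t)%:E)%E.
Proof.
move=> mA.
have pi2 : 0 <= pi / 2 :> R by rewrite divr_ge0// pi_ge0.
pose NA := -%R @^-1` A.
have mNA : measurable NA.
  by rewrite -[X in measurable X]setTI; exact: oppr_measurable.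
have := @subst_segment R (fun t : R => - cos t ^+ 2) (fun t => 2 * sin t * cos t) 0
  (pi / 2) pi2
  (@is_derive_sqr_cos R) _ _ _ NA mNA.
rewrite cos0 cos_pihalf expr1n expr0n/= oppr0.
rewrite (_ : (fun x : R => - cos x ^+ 2) @^-1` NA = (fun t => cos t ^+ 2) @^-1` A);
  last first.
  by apply/seteqP; split => x; rewrite /NA/= opprK.
move=> <-.
- rewrite -lebesgue_measureN; last exact: measurableI.
  rewrite /pushforward; congr lebesgue_measure.
  by rewrite preimage_setI opp_preimage_itvbndbnd/= oppr0.
- move=> t; apply: cvgM; last exact: continuous_cos.
  by apply: cvgM; [exact: cvg_cst|exact: continuous_sin].
- move=> x /andP[x0 x1]; rewrite !mulr_ge0//.
    by rewrite sin_ge0_pi// x0 (le_trans x1)// ler_pdivrMr// ler_peMr// ?pi_ge0// ler1n.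
  by rewrite cos_ge0_pihalf// x1 (le_trans _ x0)// oppr_le0.
- move=> x /andP[x0 x1]; rewrite !mulr_gt0//.
    by rewrite sin_gt0_pihalf// x0 x1.
  by rewrite cos_gt0_pihalf// x1 (le_lt_trans _ x0)// oppr_le0.
Qed.

(** * Tonelli and dilations for Lebesgue measure on column vectors *)

Lemma measurable_col_mx (R : realType) m l :
  measurable_fun [set: 'cV[R]_m * 'cV[R]_l]
    (fun p : 'cV[R]_m * 'cV[R]_l => col_mx p.1 p.2 : 'cV[R]_(m + l)).
Proof.
apply: measurable_fun_cV => i.
have [j ->|j ->] := split_ordP i.
  under eq_fun do rewrite col_mxEu.
  exact: (measurableT_comp (measurable_cV_coord j) measurable_fst).
under eq_fun do rewrite col_mxEd.
exact: (measurableT_comp (measurable_cV_coord j) measurable_snd).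
Qed.

Lemma measurable_cV_scale (R : realType) n d (T : measurableType d)
    (a : T -> R) (x : T -> 'cV[R]_n) :
  measurable_fun [set: T] a -> measurable_fun [set: T] x ->
  measurable_fun [set: T] (fun t => a t *: x t).
Proof.
move=> ma mx; apply: measurable_fun_cV => i; under eq_fun do rewrite mxE.
by apply: measurable_funM => //; exact: (measurableT_comp (measurable_cV_coord i) mx).
Qed.

(** Tonelli for the recursive definition of Lebesgue measure. *)
Lemma integral_lebesgue_cVS (R : realType) n (g : 'cV[R]_n.+1 -> \bar R) :
  measurable_fun setT g -> (forall x, 0 <= g x)%E ->
  (\int[lebesgue_cV R n.+1]_z g z =
   \int[@lebesgue_measure R]_a \int[lebesgue_cV R n]_z g (cV_cons (a, z)))%E.
Proof.
move=> mg g0.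
transitivity (\int[@lebesgue_measure R \x lebesgue_cV R n]_p g (cV_cons p))%E.
  rewrite -(@ge0_integral_pushforward _ _ _ _ R (@cV_cons R n)
    (@measurable_cV_cons R n) _ setT g)//.
rewrite fubini_tonelli1//.
exact: (measurableT_comp mg (@measurable_cV_cons R n)).
Qed.

Lemma integral_lebesgue_cV0 (R : realType) (g : 'cV[R]_0 -> \bar R) :
  measurable_fun setT g -> (\int[lebesgue_cV R 0]_z g z = g 0%R)%E.
Proof. by move=> mg; rewrite /= integral_dirac// diracT mul1e. Qed.

Lemma measurable_integral_cons (R : realType) n (g : 'cV[R]_n.+1 -> \bar R) :
  measurable_fun setT g -> (forall x, 0 <= g x)%E ->
  measurable_fun [set: R] (fun a : R => \int[lebesgue_cV R n]_z g (cV_cons (a, z)))%E.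
Proof.
move=> mg g0.
apply: (@measurable_fun_fubini_tonelli_F _ _ (measurableTypeR R) _ R
  (lebesgue_cV R n) (g \o @cV_cons R n)).
  exact: (measurableT_comp mg (@measurable_cV_cons R n)).
by move=> p; exact: g0.
Qed.

Lemma measurable_integral_col (R : realType) m l (g : 'cV[R]_(m + l) -> \bar R) :
  measurable_fun setT g -> (forall x, 0 <= g x)%E ->
  measurable_fun [set: 'cV[R]_m] (fun x => \int[lebesgue_cV R l]_y g (col_mx x y))%E.
Proof.
move=> mg g0.
apply: (@measurable_fun_fubini_tonelli_F _ _ _ _ R (lebesgue_cV R l)
  (fun p : 'cV[R]_m * 'cV[R]_l => g (col_mx p.1 p.2))).
  exact: (measurableT_comp mg (@measurable_col_mx R m l)).
by move=> p; exact: g0.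
Qed.

Lemma col_mx_cons (R : realType) m l (a : R) (x : 'cV[R]_m) (y : 'cV[R]_l) :
  col_mx (cV_cons (a, x) : 'cV[R]_(m.+1)) y = cV_cons (a, col_mx x y) :>
    'cV[R]_(m.+1 + l).
Proof.
rewrite /cV_cons /=; apply/matrixP => i j.
have [k -> | k ->] := split_ordP (i : 'I_(1 + (m + l))).
  rewrite [RHS]col_mxEu (_ : lshift (m + l) k = lshift l (lshift m k));
    last exact: val_inj.
  by rewrite [LHS]col_mxEu [LHS]col_mxEu.
rewrite [RHS]col_mxEd; have [k' -> | k' ->] := split_ordP k.
  rewrite [RHS]col_mxEu (_ : rshift 1 (lshift l k') = lshift l (rshift 1 k'));
    last exact: val_inj.
  by rewrite [LHS]col_mxEu [LHS]col_mxEd.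
rewrite [RHS]col_mxEd (_ : rshift 1 (rshift m k') = rshift m.+1 k');
  last exact: val_inj.
by rewrite [LHS]col_mxEd.
Qed.

(** Both sides peel off the coordinates of x one at a time. *)
Lemma integral_lebesgue_cV_col (R : realType) m l (g : 'cV[R]_(m + l) -> \bar R) :
  measurable_fun setT g -> (forall x, 0 <= g x)%E ->
  (\int[lebesgue_cV R (m + l)]_z g z =
   \int[lebesgue_cV R m]_x \int[lebesgue_cV R l]_y g (col_mx x y))%E.
Proof.
elim: m => [|m ih] in g *.
  move=> mg g0.
  rewrite integral_lebesgue_cV0; last exact: measurable_integral_col.
  apply: eq_integral => y _; congr g.
  apply/matrixP => i j; have := col_mxEd (0 : 'cV[R]_0) y i j.
  by rewrite (_ : rshift 0 i = i) => [->//|]; exact: val_inj.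
move=> mg g0.
rewrite (@integral_lebesgue_cVS R (m + l) g)//.
rewrite (@integral_lebesgue_cVS R m); last 2 first.
- exact: measurable_integral_col.
- by move=> x; exact: integral_ge0.
apply: eq_integral => a _; rewrite (ih (fun z => g (cV_cons (a, z)))); last 2 first.
- have ma : measurable_fun [set: 'cV[R]_(m + l)] (fun z => (a : measurableTypeR R,
  z)) by exact: measurable_pair1.
  exact: (measurableT_comp mg (measurableT_comp (@measurable_cV_cons R (m + l)) ma)).
- by [].
by apply: eq_integral => x _; apply: eq_integral => y _; rewrite col_mx_cons.
Qed.

Lemma cV_consZ (R : realType) n (r a : R) (z : 'cV[R]_n) :
  r *: cV_cons (a, z) = cV_cons (r * a, r *: z).
Proof.
rewrite /cV_cons/= -scale_scalar_mx.
exact: (@scale_col_mx R 1 n 1 r).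
Qed.

Lemma integral_lebesgue_cV_scale (R : realType) n (r : R) (g : 'cV[R]_n ->
  \bar R) : 0 < r ->
  measurable_fun setT g -> (forall x, 0 <= g x)%E ->
  (\int[lebesgue_cV R n]_z g (r *: z)%R = (r^-1 ^+ n)%:E * \int[lebesgue_cV R
    n]_z g z)%E.
Proof.
move=> r0; elim: n => [|n ih] in g *; move=> mg g0.
  have mgr := measurableT_comp mg (measurable_cV_scale (measurable_cst r)
    (@measurable_id _ 'cV[R]_0 setT)).
  by rewrite !integral_lebesgue_cV0//= expr0 mul1e scaler0.
have mgr := measurableT_comp mg (measurable_cV_scale (measurable_cst r)
  (@measurable_id _ 'cV[R]_n.+1 setT)).
rewrite !integral_lebesgue_cVS//.
under eq_integral => a _.
  under eq_integral do rewrite cV_consZ.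
  rewrite (ih (fun z => g (cV_cons ((r * a)%R, z)))); last 2 first.
    have ma : measurable_fun [set: 'cV[R]_n]
      (fun z => ((r * a)%R : measurableTypeR R, z)) by exact: measurable_pair1.
    exact: (measurableT_comp mg (measurableT_comp (@measurable_cV_cons R n) ma)).
    by [].
  over.
have mG := measurable_integral_cons mg g0.
have r1 : (0 <= r^-1 ^+ n)%R by rewrite exprn_ge0// invr_ge0 ltW.
rewrite (@ge0_integral_scale R r (fun a => (r^-1 ^+ n)%:E * \int[lebesgue_cV R n]_z
  g (cV_cons (a, z))))%E//; last 2 first.
- by apply: emeasurable_funM => //; exact: measurable_cst.
- by move=> a; rewrite mule_ge0// ?integral_ge0// lee_fin.
rewrite ge0_integralZl//; last by move=> a _; exact: integral_ge0.
by rewrite muleA -EFinM exprS.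
Qed.

(** * Radial integrals and the area of the unit sphere *)

Lemma dot_ge0 (R : realType) n (z : 'cV[R]_n) : 0 <= dot z z.
Proof. by rewrite dotE; apply: sumr_ge0 => i _; rewrite -expr2 sqr_ge0. Qed.

Lemma sqr_enorm (R : realType) n (z : 'cV[R]_n) : enorm z ^+ 2 = dot z z.
Proof. by rewrite sqr_sqrtr// dot_ge0. Qed.

Lemma enorm_ge0 (R : realType) n (z : 'cV[R]_n) : 0 <= enorm z.
Proof. exact: sqrtr_ge0. Qed.

Lemma dot_col_mx (R : realType) m l (x x' : 'cV[R]_m) (y y' : 'cV[R]_l) :
  dot (col_mx x y) (col_mx x' y') = dot x x' + dot y y'.
Proof.
by rewrite /dot tr_col_mx mul_row_col mxE.
Qed.

Lemma dot_cV_cons (R : realType) n (a : R) (z : 'cV[R]_n) :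
  dot (cV_cons (a, z)) (cV_cons (a, z)) = a ^+ 2 + dot z z.
Proof.
rewrite [LHS](@dot_col_mx R 1 n); congr (_ + _).
by rewrite dotE big_ord1 !mxE/= expr2.
Qed.

Lemma dotZ (R : realType) n (r : R) (z : 'cV[R]_n) :
  dot (r *: z) (r *: z) = r ^+ 2 * dot z z.
Proof.
by rewrite /dot -scalemxAr [in X in X *m _]linearZ -scalemxAl scalerA mxE expr2.
Qed.

Lemma measurable_dot (R : realType) n : measurable_fun [set: 'cV[R]_n]
  (fun z => dot z z).
Proof.
under eq_fun do rewrite dotE.
by apply: measurable_sum => i; apply: measurable_funM; exact: measurable_cV_coord.
Qed.

Lemma measurable_gauss_cV (R : realType) n :
  measurable_fun [set: 'cV[R]_n] (fun z => (expR (- dot z z))%:E).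
Proof.
apply/measurable_EFinP; apply: measurableT_comp => //.
by apply: measurableT_comp => //; exact: measurable_dot.
Qed.

(** The Gaussian is a product of functions of one coordinate. *)
Lemma integral_gauss_cV (R : realType) n :
  (\int[lebesgue_cV R n]_z (expR (- dot z z))%:E = (Num.sqrt pi ^+ n)%:E)%E.
Proof.
elim: n => [|n ih].
  rewrite integral_lebesgue_cV0; last exact: measurable_gauss_cV.
  by rewrite dotE big_ord0 oppr0 expR0 expr0.
rewrite integral_lebesgue_cVS; [|exact: measurable_gauss_cV|by move=> x;
  rewrite lee_fin expR_ge0].
under eq_integral => a _.
  under eq_integral => z _ do rewrite dot_cV_cons opprD expRD EFinM.
  rewrite ge0_integralZl//; last exact: measurable_gauss_cV.
  rewrite ih.
  over.
rewrite ge0_integralZr//; last first.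
  have mg : measurable_fun [set: R] (fun x : R => (expR (- x ^+ 2))%:E).
    by apply/measurable_EFinP; exact: measurable_gauss_fun.
  exact: mg.
by rewrite [X in (X * _)%E](@integralT_gauss R) -EFinM exprS.
Qed.

Lemma lebesgue_cV_scale (R : realType) n (r : R) (A : set 'cV[R]_n) : 0 < r ->
  measurable A ->
  (lebesgue_cV R n ((fun z => r *: z) @^-1` A) = (r^-1 ^+ n)%:E * lebesgue_cV R n A)%E.
Proof.
move=> r0 mA.
have mr := measurable_cV_scale (measurable_cst r) (@measurable_id _ 'cV[R]_n setT).
have mrA : measurable ((fun z => r *: z) @^-1` A).
  by rewrite -[X in measurable X]setTI; exact: mr.
rewrite -[A in RHS]setIT -integral_indic// -(integral_lebesgue_cV_scale r0)//;
  last first.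
  by apply/measurable_EFinP; exact: measurable_indic.
by rewrite -[in LHS](setIT (_ @^-1` _)) -integral_indic.
Qed.

Lemma measurable_enorm_le (R : realType) n (r : R) :
  measurable [set z : 'cV[R]_n | enorm z <= r].
Proof.
rewrite (_ : [set _ | _] = setT `&` @enorm R n @^-1` `]-oo, r]%classic).
  exact: measurable_enorm.
by apply/seteqP; split => z /=; rewrite in_itv/= => // -[].
Qed.

Lemma measurable_enorm_gt0 (R : realType) n :
  measurable [set z : 'cV[R]_n | 0 < enorm z].
Proof.
rewrite (_ : [set _ | _] = ~` [set z | enorm z <= 0]).
  by apply: measurableC; exact: measurable_enorm_le.
by apply/seteqP; split => z /=; [rewrite ltNge => /negP|move=> /negP; rewrite -ltNge].
Qed.

(** On the unit ball 1 <= e * exp (- |z|^2), and the Gaussian has a finite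
    integral. *)
Lemma lebesgue_cV_ball_lty (R : realType) n :
  (lebesgue_cV R n [set z | (enorm z <= 1)%R] < +oo)%E.
Proof.
have mB := @measurable_enorm_le R n 1.
apply: (@le_lt_trans _ _ ((expR 1)%:E * (Num.sqrt pi ^+ n)%:E)%E);
  last by rewrite -EFinM ltry.
rewrite -integral_gauss_cV -ge0_integralZl//; last exact: measurable_gauss_cV.
rewrite -[X in lebesgue_cV _ _ X]setIT -integral_indic//.
apply: ge0_le_integral => //.
- by apply/measurable_EFinP; exact: measurable_indic.
- apply: emeasurable_funM; [exact: measurable_cst|exact: measurable_gauss_cV].
move=> z _; rewrite -EFinM lee_fin -expRD indicE.
case: (boolP (_ \in _)) => [|_]; last exact: expR_ge0.
rewrite inE /= => z1; rewrite (le_trans _ (expR_ge1Dx _))// lerDl subr_ge0 -sqr_enorm.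
by rewrite expr_le1// enorm_ge0.
Qed.

Definition ball_volume (R : realType) n : R :=
  fine (lebesgue_cV R n [set z | (enorm z <= 1)%R]).

Lemma ball_volume_ge0 (R : realType) n : 0 <= ball_volume R n.
Proof. exact: fine_ge0. Qed.

Lemma lebesgue_cV_ball (R : realType) n (r : R) : 0 < r ->
  lebesgue_cV R n [set z | (enorm z <= r)%R] = (r ^+ n * ball_volume R n)%:E.
Proof.
move=> r0; have r'0 : 0 < r^-1 by rewrite invr_gt0.
rewrite (_ : [set _ | _] = (fun z => r^-1 *: z) @^-1` [set z | (enorm z <= 1)%R]);
  last first.
  by apply/seteqP; split => z /=; rewrite enormZ ?(ltW r'0)// ler_pdivrMl// mulr1.
rewrite lebesgue_cV_scale//; last exact: measurable_enorm_le.
by rewrite invrK EFinM /ball_volume fineK// ge0_fin_numE// lebesgue_cV_ball_lty.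
Qed.

(** The set is invariant under z |-> 2 z, which multiplies volumes by 2^n, and
    its volume is finite. *)
Lemma lebesgue_cV_ball0 (R : realType) n : (0 < n)%N ->
  lebesgue_cV R n [set z | (enorm z <= 0)%R] = 0%E.
Proof.
move=> n0; have mB := @measurable_enorm_le R n 0.
have fB : lebesgue_cV R n [set z | (enorm z <= 0)%R] \is a fin_num.
  rewrite ge0_fin_numE// (le_lt_trans _ (lebesgue_cV_ball_lty R n))//.
  rewrite le_measure ?inE//; first exact: measurable_enorm_le.
  by move=> z /= /le_trans; apply.
(* both sides of the scaling formula are the volume of the same set *)
have := @lebesgue_cV_scale R n 2 _ (ltr0n _ 2) mB.
rewrite (_ : _ @^-1` _ = [set z : 'cV[R]_n | enorm z <= 0]); last first.
  by apply/seteqP; split => z /=; rewrite enormZ// pmulr_rle0.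
rewrite -(fineK fB) -EFinM => -[] /eqP;
  rewrite -subr_eq0 -{1}[fine _]mul1r -mulrBl mulf_eq0.
rewrite subr_eq0 => /orP[/eqP h|/eqP -> //].
have : (2^-1 : R) ^+ n < 1 by rewrite exprn_ilt1// ?invf_lt1 ?ltr1n// -lt0n.
by rewrite -h ltxx.
Qed.

(** The ball of radius r has volume r^n times that of the unit ball, which is
    the integral of the density on the right-hand side over ]0, r]. *)
Lemma lebesgue_cV_enorm (R : realType) n (A : set R) : (0 < n)%N -> measurable A ->
  lebesgue_cV R n (@enorm R n @^-1` A) =
  (\int[@lebesgue_measure R]_(p in `]0%R, +oo[ `&` A)
    (ball_volume R n * (n%:R * p ^+ n.-1))%:E)%E.
Proof.
move=> n0 mA.
have men : measurable_fun [set: 'cV[R]_n] (@enorm R n : _ -> measurableTypeR R)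
  by exact: measurable_enorm.
have dG (p : R) : is_derive p (1 : R) (fun p => ball_volume R n * p ^+ n)
  (ball_volume R n * (n%:R * p ^+ n.-1)).
  have dX : is_derive p (1 : R) (fun p : R => p ^+ n) (n%:R * p ^+ n.-1).
    have := @is_deriveX _ _ (@idfun R^o) n p (1 : R) 1 (is_derive_id _ _).
    by rewrite [_ *: _]mulr1 exprfctE.
  exact: (is_deriveZ (ball_volume R n) dX).
have cg : continuous (fun p : R => ball_volume R n * (n%:R * p ^+ n.-1)).
  move=> p; apply: cvgM; first exact: cvg_cst.
  by apply: cvgM; [exact: cvg_cst|exact: exprn_continuous].
have mg : measurable_fun [set: R] (fun p : R => ball_volume R n * (n%:R * p ^+ n.-1)).
  exact: continuous_measurable_fun.
have key (a : R) : lebesgue_cV R n (@enorm R n @^-1` `]-oo, a]%classic) =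
  (\int[@lebesgue_measure R]_(p in `]0%R, +oo[ `&` `]-oo, a])
    (ball_volume R n * (n%:R * p ^+ n.-1))%:E)%E.
  rewrite (_ : _ @^-1` _ = [set z : 'cV[R]_n | enorm z <= a]); last first.
    by apply/seteqP; split => z /=; rewrite in_itv.
  have [a0|a0] := leP a 0.
    rewrite (_ : _ `&` _ = set0); last first.
      apply/seteqP; split => // x []/=; rewrite !in_itv/= andbT => x0 xa.
      by have := lt_le_trans x0 (le_trans xa a0); rewrite ltxx.
    rewrite integral_set0; apply/eqP; rewrite -measure_le0 -(lebesgue_cV_ball0 R n0).
    rewrite le_measure ?inE//; try exact: measurable_enorm_le.
    by move=> z /= /le_trans; apply.
  rewrite lebesgue_cV_ball// (_ : _ `&` _ = `]0, a]%classic); last first.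
    apply/seteqP; split => x /=; rewrite !in_itv/= ?andbT; first by move=> [-> ->].
    by move=> /andP[-> ->].
  rewrite integral_itv_obnd_cbnd; last first.
    by apply/measurable_EFinP; exact: measurable_funS mg.
  by rewrite (FTC_ge0 (ltW a0) dG cg) expr0n gtn_eqF//= mulr0 subr0 mulrC.
apply: (@pushdens_rays _ (measurableTypeR R) R (@lebesgue_measure R) id
  (fun p => ball_volume R n * (n%:R * p ^+ n.-1)) `]0%R, +oo[%classic
  (pushforward (lebesgue_cV R n) (@enorm R n : _ -> measurableTypeR R))) => //.
- exact: measurable_funS mg.
- move=> x /=; rewrite in_itv/= andbT => x0.
  by rewrite !mulr_ge0// ?ball_volume_ge0// exprn_ge0// ltW.
move=> a; apply: (@le_lt_trans _ _ (lebesgue_cV R n [set z | (enorm z <=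
  Num.max a 1)%R])).
  suff : (lebesgue_cV R n (@enorm R n @^-1` `]-oo, a]%classic) <=
      lebesgue_cV R n [set z | (enorm z <= Num.max a 1)%R])%E by exact.
  rewrite le_measure ?inE//.
  - by rewrite -[X in measurable X]setTI; exact: men.
  - exact: measurable_enorm_le.
  - by move=> z /=; rewrite in_itv/= le_max => ->.
by rewrite lebesgue_cV_ball ?ltry// lt_max ltr01 orbT.
Qed.

Lemma integral_enorm (R : realType) n (g : R -> \bar R) : (0 < n)%N ->
  measurable_fun [set: R] g -> (forall x, 0 <= g x)%E ->
  (\int[lebesgue_cV R n]_z g (enorm z) =
   \int[@lebesgue_measure R]_(p in `]0%R, +oo[)
     (g p * (ball_volume R n * (n%:R * p ^+ n.-1))%:E))%E.
Proof.
move=> n0 mg g0.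
have men : measurable_fun [set: 'cV[R]_n] (@enorm R n : _ -> measurableTypeR R)
  by exact: measurable_enorm.
have mh : measurable_fun [set: R] (fun p : R => ball_volume R n * (n%:R * p ^+ n.-1)).
  apply: measurable_funM => //; apply: measurable_funM => //; exact: exprn_measurable.
transitivity (\int[pushforward (lebesgue_cV R n) (@enorm R n : _ -> measurableTypeR
  R)]_p g p)%E.
  by rewrite ge0_integral_pushforward.
apply: (@ge0_integral_pushdens _ _ (measurableTypeR R) (measurableTypeR R) R
  (@lebesgue_measure R) (pushforward (lebesgue_cV R n) (@enorm R n : _ ->
    measurableTypeR R))
  id (fun p => ball_volume R n * (n%:R * p ^+ n.-1))) => //.
- exact: measurable_funS mh.
- move=> x /=; rewrite in_itv/= andbT => x0.
  by rewrite !mulr_ge0// ?ball_volume_ge0// exprn_ge0// ltW.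
- by move=> A mA _; exact: (lebesgue_cV_enorm n0 mA).
Qed.

(** Substitution t = p^2; the left-hand side is the Gamma integral at
    (n + 1) / 2. *)
Lemma gamma_integral_gauss (R : realType) n :
  (\int[@lebesgue_measure R]_(t in `]0%R, +oo[) (t `^ (n.+1%:R / 2 - 1) * expR
    (- t))%:E =
   2%:E * \int[@lebesgue_measure R]_(p in `]0%R, +oo[) (expR (- p ^+ 2) * p ^+ n)%:E)%E.
Proof.
pose g (t : R) := t `^ (n.+1%:R / 2 - 1) * expR (- t).
have mg : measurable_fun [set: R] g.
  apply: measurable_funM; first exact: measurable_powR.
  by apply: measurableT_comp => //; exact: measurableT_comp.
have msq : measurable_fun [set: R] (fun t : R => t ^+ 2) by exact: exprn_measurable.
rewrite (@ge0_integral_pushdens _ _ (measurableTypeR R) (measurableTypeR R) R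
  lebesgue_measure lebesgue_measure (fun t => t ^+ 2) (fun t => 2 * t) `]0, +oo[%classic
  `]0, +oo[%classic (EFin \o g)) => //; last 6 first.
- have m2 : measurable_fun [set: R] (fun t : R => 2 * t) by exact: measurable_funM.
  exact: measurable_funS m2.
- by move=> x /=; rewrite in_itv/= andbT => x0; rewrite mulr_ge0// ltW.
- by move=> x /=; rewrite !in_itv/= !andbT => x0; rewrite exprn_gt0.
- move=> A mA A0; have := subst_sqr mA.
  rewrite setIidl; last by move=> x /A0 /=; rewrite !in_itv/= !andbT => /ltW.
  move=> h; apply: (etrans h); congr integral; apply/seteqP; split => x /= [];
    rewrite /= !in_itv/= !andbT => x0 Ax; split => //; last exact: ltW.
  by have := A0 _ Ax; rewrite /= in_itv/= andbT;
    rewrite !lt_def sqr_ge0 x0 sqrf_eq0 => /andP[->].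
- by apply/measurable_EFinP; exact: measurable_funS mg.
- by move=> y _; rewrite lee_fin mulr_ge0 ?powR_ge0 ?expR_ge0.
rewrite -ge0_integralZl//; last first.
- by move=> x /=; rewrite in_itv/= andbT => x0;
  rewrite lee_fin mulr_ge0 ?expR_ge0 ?exprn_ge0// ltW.
- apply/measurable_EFinP; apply: measurable_funM; last exact: exprn_measurable.
  by apply: (measurable_funS measurableT) => //; exact: measurable_gauss_fun.
apply: eq_integral => x /[!inE] /=; rewrite in_itv/= andbT => x0.
rewrite -!EFinM; congr EFin; rewrite /g.
have -> : (x ^+ 2) `^ (n.+1%:R / 2 - 1) = x `^ (n.+1%:R - 2).
  rewrite -powR_mulrn ?(ltW x0)// -powRrM; congr powR.
  by rewrite mulrBr mulrCA divff// !mulr1.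
have -> : (x : R) ^+ n = x `^ (n.+1%:R - 2) * x.
  rewrite -{3}(powRr1 (ltW x0)) -powRD; last by rewrite (gt_eqF x0) implybT.
  by rewrite -powR_mulrn ?(ltW x0)//; congr powR; rewrite -natr1; ring.
ring.
Qed.

(** The Gaussian integral over R^(n + 1) is pi^((n + 1) / 2) by Tonelli, and
    (n + 1) * ball_volume * Gamma ((n + 1) / 2) / 2 in polar coordinates. The
    equality also forces the Gamma integral to be finite and nonzero, so that
    one may divide by it. *)
Lemma sigma_ball_volume (R : realType) n : n.+1%:R * ball_volume R n.+1 = sigma R n.
Proof.
have mh : measurable_fun [set: R] (fun p : R => expR (- p ^+ 2) * p ^+ n).
  by apply: measurable_funM; [exact: measurable_gauss_fun|exact: exprn_measurable].
pose I := (\int[@lebesgue_measure R]_(p in `]0%R, +oo[)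
  (expR (- p ^+ 2) * p ^+ n)%:E)%E.
have I0 : (0 <= I)%E.
  apply: integral_ge0 => x /=; rewrite in_itv/= andbT => x0.
  by rewrite lee_fin mulr_ge0 ?expR_ge0 ?exprn_ge0// ltW.
have G2 : Gamma (n.+1%:R / 2) = fine (2%:E * I) :> R.
  by rewrite /Gamma /Rintegral gamma_integral_gauss.
have : ((Num.sqrt pi ^+ n.+1)%:E = (n.+1%:R * ball_volume R n.+1)%:E * I)%E.
  rewrite -integral_gauss_cV.
  under eq_integral do rewrite -sqr_enorm.
  rewrite (@integral_enorm R n.+1 (fun p => (expR (- p ^+ 2))%:E))//; last first.
    by apply/measurable_EFinP; exact: measurable_gauss_fun.
  rewrite -ge0_integralZl//.
  - by apply: eq_integral => p _; rewrite -!EFinM; congr EFin; rewrite /=; ring.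
  - by apply/measurable_EFinP; exact: measurable_funS mh.
  - move=> x /=; rewrite in_itv/= andbT => x0.
    by rewrite lee_fin mulr_ge0 ?expR_ge0 ?exprn_ge0// ltW.
  - by rewrite lee_fin mulr_ge0// ball_volume_ge0.
have sp : 0 < Num.sqrt pi ^+ n.+1 :> R by rewrite exprn_gt0// sqrtr_gt0 pi_gt0.
move: G2 I0; case: I => [i| |]//=.
  move=> GE i0 [] piE.
  have i_neq0 : i != 0 by apply/eqP => i_eq0; move: sp; rewrite piE i_eq0 mulr0 ltxx.
  rewrite /sigma GE; have -> : pi `^ (n.+1%:R / 2) = Num.sqrt pi ^+ n.+1 :> R.
    by rewrite mulrC powRrM powR12_sqrt ?pi_ge0// powR_mulrn ?sqrtr_ge0.
  by rewrite piE; field.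
move=> _ _; have := ball_volume_ge0 R n.+1; rewrite le_eqVlt => /predU1P[<-|v0].
  by rewrite mulr0 mul0e => -[] h; move: sp; rewrite h ltxx.
by rewrite mulry gtr0_sg ?mul1e// mulr_gt0.
Qed.

(** * The image of the surface measure under the parameter s *)

Lemma sparam_col_mx (R : realType) m l (x : 'cV[R]_m) (y : 'cV[R]_l) :
  sparam l (col_mx x y : 'cV[R]_(m + l)) = dot y y.
Proof.
rewrite /sparam; have -> : Pr R (m + l) l = block_mx 0 0 0 1%:M.
  apply/matrixP => i j; rewrite [LHS]mxE addnK.
  have [i' -> | i' ->] := split_ordP i; have [j' -> | j' ->] := split_ordP j.
  - by rewrite block_mxEul mxE /= leqNgt ltn_ord andbF.
  - by rewrite block_mxEur mxE eq_lrshift.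
  - by rewrite block_mxEdl mxE eq_rlshift.
  - by rewrite block_mxEdr mxE eq_rshift /= leq_addr andbT.
rewrite tr_col_mx -mulmxA mul_block_col !mul0mx !add0r mul1mx mul_row_col mulmx0 add0r.
by [].
Qed.

Lemma measurable_sparam (R : realType) n l :
  measurable_fun [set: 'cV[R]_n] (@sparam R n l).
Proof.
rewrite /sparam; under eq_fun do rewrite mxE.
apply: measurable_sum => i; apply: measurable_funM; last exact: measurable_cV_coord.
under eq_fun do rewrite mxE.
apply: measurable_sum => j; apply: measurable_funM; last exact: measurable_cst.
by under eq_fun do rewrite mxE; exact: measurable_cV_coord.
Qed.

Lemma sparamZ (R : realType) n l (r : R) (z : 'cV[R]_n) :
  sparam l (r *: z) = r ^+ 2 * sparam l z.
Proof. by rewrite /sparam -scalemxAr [in X in X *m _]linearZ -!scalemxAl scalerA mxE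
  expr2. Qed.

Lemma enorm_col_mx (R : realType) m l (x : 'cV[R]_m) (y : 'cV[R]_l) :
  enorm (col_mx x y : 'cV[R]_(m + l)) ^+ 2 = enorm x ^+ 2 + enorm y ^+ 2.
Proof. by rewrite !sqr_enorm dot_col_mx. Qed.

(** The factor (0 < p) turns the integrals over the half-line into integrals
    over the line, to which Tonelli and the dilations apply without domains. *)
Definition radial_density (R : realType) n (p : R) : R :=
  (0 < p)%R%:R * (n%:R * ball_volume R n * p ^+ n.-1).

Lemma radial_density_ge0 (R : realType) n (p : R) : 0 <= radial_density n p.
Proof.
rewrite /radial_density; have [p0|_] := ltP 0 p; last by rewrite mul0r.
by rewrite mul1r !mulr_ge0 ?ball_volume_ge0 ?exprn_ge0// ltW.
Qed.

Lemma measurable_fun_pos (R : realType) : measurable_fun [set: R]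
  (fun p : R => ((0 < p)%R%:R : R)).
Proof.
rewrite (_ : (fun p => _) = \1_(`]0, +oo[%classic : set R)).
  exact: measurable_indic.
apply/funext => p; rewrite indicE; congr (_ %:R); congr nat_of_bool.
by apply/idP/idP; rewrite inE /= in_itv/= andbT.
Qed.

Lemma measurable_radial_density (R : realType) n : measurable_fun [set: R]
  (@radial_density R n).
Proof.
apply: measurable_funM; first exact: measurable_fun_pos.
by apply: measurable_funM => //; exact: exprn_measurable.
Qed.

Lemma integral_enormT (R : realType) n (g : R -> \bar R) : (0 < n)%N ->
  measurable_fun [set: R] g -> (forall x, 0 <= g x)%E ->
  (\int[lebesgue_cV R n]_z g (enorm z) =
   \int[@lebesgue_measure R]_p (g p * (radial_density n p)%:E))%E.
Proof.
move=> n0 mg g0; rewrite integral_enorm// integral_mkcond.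
apply: eq_integral => p _; rewrite patchE /radial_density.
have -> : (p \in `]0, +oo[%classic) = (0 < p) by apply/idP/idP;
  rewrite inE/= in_itv/= andbT.
by case: ifPn => _; rewrite ?mul1r ?mul0r ?mule0// mulrCA mulrA.
Qed.

Lemma integral_radial_power (R : realType) n (r : R) : 0 < r ->
  (\int[@lebesgue_measure R]_(p in `]0%R, r]) (p ^+ n)%:E = (r ^+ n.+1 / n.+1%:R)%:E)%E.
Proof.
move=> r0.
have dG (p : R) : is_derive p (1 : R) (fun p => n.+1%:R^-1 * p ^+ n.+1) (p ^+ n).
  have dX : is_derive p (1 : R) (fun p : R => p ^+ n.+1) (n.+1%:R * p ^+ n).
    have := @is_deriveX _ _ (@idfun R^o) n.+1 p (1 : R) 1 (is_derive_id _ _).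
    by rewrite [_ *: _]mulr1 exprfctE.
  have := is_deriveZ (n.+1%:R^-1) dX.
  by rewrite /GRing.scale/= mulKf.
rewrite integral_itv_obnd_cbnd; last first.
  apply/measurable_EFinP; apply: (measurable_funS measurableT) => //;
    exact: exprn_measurable.
rewrite (FTC_ge0 (ltW r0) dG); last exact: exprn_continuous.
by rewrite expr0n/= mulr0 subr0 mulrC.
Qed.

(** Polar coordinates in each of the two factors. *)
Lemma integral_two_enorms (R : realType) m l (G : R * R -> \bar R) :
  (0 < m)%N -> (0 < l)%N -> measurable_fun [set: R * R] G -> (forall u, 0 <= G u)%E ->
  (\int[lebesgue_cV R m]_x \int[lebesgue_cV R l]_y G (enorm x, enorm y) =
   \int[@lebesgue_measure R]_p \int[@lebesgue_measure R]_q
     (G (p, q) * (radial_density l q * radial_density m p)%:E))%E.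
Proof.
move=> m0 l0 mG G0.
have mGp (p : R) : measurable_fun [set: R] (fun q : R => G (p, q)).
  exact: (measurableT_comp mG (measurable_pair1 p)).
under eq_integral do rewrite (@integral_enormT R l (fun q => G (enorm _, q)))//.
pose F (p : R) := (\int[@lebesgue_measure R]_q (G (p, q) * (radial_density l q)%:E))%E.
have mGl : measurable_fun [set: R * R]
  (fun u : R * R => (G u * (radial_density l u.2)%:E)%E).
  apply: emeasurable_funM => //; apply/measurable_EFinP.
  exact: (measurableT_comp (@measurable_radial_density R l) measurable_snd).
have Gl0 u : (0 <= G u * (radial_density l u.2)%:E)%E by rewrite mule_ge0// lee_fin
  radial_density_ge0.
have mF : measurable_fun [set: R] F.
  exact: (@measurable_fun_fubini_tonelli_F _ _ (measurableTypeR R)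
    (measurableTypeR R) R (@lebesgue_measure R) _ mGl Gl0).
rewrite (@integral_enormT R m F)//; last first.
  by move=> p; apply: integral_ge0 => q _; exact: (Gl0 (p, q)).
apply: eq_integral => p _; rewrite /F -ge0_integralZr//.
- by apply: eq_integral => q _; rewrite [in RHS]EFinM [RHS]muleA.
- apply: emeasurable_funM; first exact: mGp.
  by apply/measurable_EFinP; exact: measurable_radial_density.
- by rewrite lee_fin radial_density_ge0.
Qed.

Lemma measurable_slope_integrand (R : realType) (B : set R) k n : measurable B ->
  measurable_fun [set: R] (fun t : R => \1_B (1 - (1 + t ^+ 2)^-1) *
    (t ^+ k * (Num.sqrt (1 + t ^+ 2))^-1 ^+ n) : R).
Proof.
move=> mB; have mt : measurable_fun [set: R] (fun t : R => 1 + t ^+ 2).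
  by apply: measurable_funD => //; exact: exprn_measurable.
apply: measurable_funM.
  apply: (measurableT_comp (measurable_indic mB)); apply: measurable_funB => //.
  under eq_fun do rewrite -powR_inv1 ?addr_ge0 ?sqr_ge0//.
  exact: (measurableT_comp (measurable_powR (-1)) mt).
apply: measurable_funM; first exact: exprn_measurable.
apply: (measurableT_comp (exprn_measurable _)).
under eq_fun do rewrite -powR_inv1 ?sqrtr_ge0//.
apply: (measurableT_comp (measurable_powR (-1))).
exact: (measurableT_comp (continuous_measurable_fun (@sqrt_continuous R)) mt).
Qed.

(** In terms of p = |x| and q = |y|, the cone over the part of the sphere where
    s lies in [B]. *)
Definition slope_sector (R : realType) (B : set R) : set (R * R) :=
  [set u | 0 < u.1 ^+ 2 + u.2 ^+ 2 <= 1 /\ B (u.2 ^+ 2 / (u.1 ^+ 2 + u.2 ^+ 2))].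

Lemma measurable_slope_sector (R : realType) (B : set R) : measurable B ->
  measurable (slope_sector B).
Proof.
move=> mB.
have mN : measurable_fun [set: R * R] (fun u : R * R => u.1 ^+ 2 + u.2 ^+ 2).
  apply: measurable_funD.
    exact: (measurableT_comp (exprn_measurable 2) measurable_fst).
  exact: (measurableT_comp (exprn_measurable 2) measurable_snd).
have mQ : measurable_fun [set: R * R] (fun u : R * R => u.2 ^+ 2 /
  (u.1 ^+ 2 + u.2 ^+ 2)).
  apply: measurable_funM; first exact: (measurableT_comp (exprn_measurable 2)
    measurable_snd).
  under eq_fun do rewrite -powR_inv1 ?addr_ge0 ?sqr_ge0//.
  exact: (measurableT_comp (measurable_powR (-1)) mN).
rewrite (_ : slope_sector B =
   (setT `&` (fun u : R * R => u.1 ^+ 2 + u.2 ^+ 2) @^-1` `]0, 1]%classic) `&`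
   (setT `&` (fun u : R * R => u.2 ^+ 2 / (u.1 ^+ 2 + u.2 ^+ 2)) @^-1` B)).
  by apply: measurableI; [exact: mN|exact: mQ].
by apply/seteqP; split => u; rewrite /slope_sector /= in_itv/=;
  [move=> []|move=> [[_ ?] [_ ?]]].
Qed.

(** For fixed p the dilation q = p t replaces q by the slope t = q / p. Then
    s = t^2 / (1 + t^2) depends on t only, and the p-integral is that of
    p^(m + l - 1) over p <= (1 + t^2)^(-1/2). *)
Lemma integral_slope (R : realType) m l (B : set R) :
  (0 < m)%N -> (0 < l)%N -> measurable B ->
    (\int[@lebesgue_measure R]_p \int[@lebesgue_measure R]_q
     ((\1_(slope_sector B) (p, q))%:E * (radial_density l q * radial_density m p)%:E) =
   (m%:R * ball_volume R m * (l%:R * ball_volume R l) / (m + l)%:R)%:E *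
   \int[@lebesgue_measure R]_(t in `]0%R, +oo[)
     (\1_B (1 - (1 + t ^+ 2)^-1) * (t ^+ l.-1 * (Num.sqrt (1 + t ^+ 2))^-1 ^+
       (m + l)))%:E)%E.
Proof.
move=> m0 l0 mB.
have p1 (t : R) : 0 < 1 + t ^+ 2 by rewrite ltr_wpDr ?sqr_ge0.
pose Km := m%:R * ball_volume R m; pose Kl := l%:R * ball_volume R l.
have Km0 : 0 <= Km by rewrite mulr_ge0// ball_volume_ge0.
have Kl0 : 0 <= Kl by rewrite mulr_ge0// ball_volume_ge0.
(* p times the integrand at (p, p t) *)
pose H (u : R * R) : R := (0 < u.1)%R%:R * (0 < u.2)%R%:R * \1_B
  (1 - (1 + u.2 ^+ 2)^-1) *
  (u.1 ^+ 2 * (1 + u.2 ^+ 2) <= 1)%R%:R * (Km * Kl * (u.1 ^+ (m + l).-1 * u.2 ^+ l.-1)).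
have H0 u : 0 <= H u.
  rewrite /H; have [a0|_] := ltP 0 u.1; last by rewrite !mul0r.
  have [b0|_] := ltP 0 u.2; last by rewrite !(mul0r,mulr0).
  have e1 : 0 <= u.1 ^+ (m + l).-1 by rewrite exprn_ge0// ltW.
  have e2 : 0 <= u.2 ^+ l.-1 by rewrite exprn_ge0// ltW.
  by rewrite !mulr_ge0// ball_volume_ge0.
have m1 : measurable_fun [set: R * R] (fun u : R * R => u.1) by exact: measurable_fst.
have m2 : measurable_fun [set: R * R] (fun u : R * R => u.2) by exact: measurable_snd.
have msq (f : R * R -> R) : measurable_fun [set: R * R] f -> measurable_fun [set: R
  * R] (fun u => f u ^+ 2).
  by move=> mf; exact: (measurableT_comp (exprn_measurable 2) mf).
have mV (f : R * R -> R) : measurable_fun [set: R * R] f -> (forall u, 0 <= f u) ->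
    measurable_fun [set: R * R] (fun u => (f u)^-1).
  move=> mf f0; under eq_fun do rewrite -powR_inv1//.
  exact: (measurableT_comp (measurable_powR (-1)) mf).
have mle (f : R * R -> R) : measurable_fun [set: R * R] f ->
    measurable_fun [set: R * R] (fun u => (f u <= 1)%R%:R : R).
  move=> mf; rewrite (_ : (fun u => _) = \1_(`]-oo, 1%R]%classic) \o f).
    by apply: measurableT_comp => //; exact: measurable_indic.
  by apply/funext => u /=; rewrite indicE; congr (_ %:R); congr nat_of_bool;
    apply/idP/idP; rewrite inE /= in_itv.
have mH : measurable_fun [set: R * R] H.
  apply: measurable_funM; last first.
    apply: measurable_funM => //; apply: measurable_funM.
      exact: (measurableT_comp (exprn_measurable _) m1).
    exact: (measurableT_comp (exprn_measurable _) m2).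
  apply: measurable_funM; last first.
    apply: mle; apply: measurable_funM; first exact: msq.
    by apply: measurable_funD => //; exact: msq.
  apply: measurable_funM; last first.
    apply: (measurableT_comp (measurable_indic mB)).
    apply: measurable_funB => //; apply: mV; last by move=> u; exact/ltW.
    by apply: measurable_funD => //; exact: msq.
  apply: measurable_funM; first exact: (measurableT_comp (@measurable_fun_pos R) m1).
  exact: (measurableT_comp (@measurable_fun_pos R) m2).
have mC : measurable_fun [set: R * R] (\1_(slope_sector B) : R * R -> R).
  by apply: measurable_indic; exact: measurable_slope_sector.
have HC (p t : R) : 0 < p ->
  \1_(slope_sector B) (p, p * t) * (radial_density l (p * t) * radial_density m p) =
    p^-1 * H (p, t).
  move=> p0; rewrite /radial_density /H /= p0 pmulr_rgt0//.
  have [t0|_] := ltP 0 t; last by rewrite !(mulr0,mul0r).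
  rewrite !mul1r.
  have -> : \1_(slope_sector B) (p, p * t) = \1_B (1 - (1 + t ^+ 2)^-1) *
    (p ^+ 2 * (1 + t ^+ 2) <= 1)%R%:R :> R.
    have e1 : p ^+ 2 + (p * t) ^+ 2 = p ^+ 2 * (1 + t ^+ 2) by ring.
    have e2 : (p * t) ^+ 2 / (p ^+ 2 * (1 + t ^+ 2)) = 1 - (1 + t ^+ 2)^-1.
      by field; rewrite (gt_eqF (p1 t)) (gt_eqF p0).
    rewrite !indicE -natrM mulnb; congr (_ %:R); congr nat_of_bool.
    apply/idP/andP; rewrite !inE /slope_sector/= e1 e2.
      by move=> [/andP[_ ?] ?].
    by move=> [? ->]; rewrite mulr_gt0 ?exprn_gt0//.
  rewrite -/Km -/Kl exprMn.
  have -> : p ^+ (m + l).-1 = p * p ^+ m.-1 * p ^+ l.-1.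
    by rewrite -exprS -exprD prednK// -{1}(prednK l0) addnS.
  by field; rewrite gt_eqF.
transitivity (\int[@lebesgue_measure R]_p \int[@lebesgue_measure R]_t (H (p, t))%:E)%E.
  apply: eq_integral => p _; have [p0|p0] := ltP 0 p; last first.
    apply: eq_integral => q _; rewrite /radial_density /H/= (leNgt p 0) in p0 *.
    by rewrite (negbTE p0) !(mul0r,mulr0) mule0.
  pose g (q : R) := ((\1_(slope_sector B) (p, q))%:E * (radial_density l q *
    radial_density m p)%:E)%E.
  have mg : measurable_fun [set: R] g.
    apply: emeasurable_funM; apply/measurable_EFinP.
      exact: (measurableT_comp mC (measurable_pair1 p)).
    by apply: measurable_funM => //; exact: measurable_radial_density.
  have g0 q : (0 <= g q)%E by rewrite mule_ge0// lee_fin// mulr_ge0//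
    radial_density_ge0.
  have := ge0_integral_scale p0 mg g0.
  under eq_integral do rewrite /g -EFinM HC// EFinM.
  have mHp : measurable_fun [set: R] (fun t => (H (p, t))%:E).
    by apply/measurable_EFinP; exact: (measurableT_comp mH (measurable_pair1 p)).
  rewrite ge0_integralZl//; last 2 first.
  - by move=> t _; rewrite lee_fin H0.
  - by rewrite lee_fin invr_ge0 ltW.
  move=> /(congr1 (fun x => p%:E * x)%E); rewrite !muleA -!EFinM divff ?gt_eqF// !mul1e.
  by move=> ->.
rewrite (@fubini_tonelli _ _ (measurableTypeR R) (measurableTypeR R) R
  (@lebesgue_measure R) (@lebesgue_measure R) (EFin \o H))//; last first.
  by apply/measurable_EFinP.
rewrite -ge0_integralZl//; last 3 first.
- have mg := @measurable_slope_integrand R B l.-1 (m + l) mB.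
  by apply/measurable_EFinP; exact: measurable_funS mg.
- by move=> t /=; rewrite in_itv/= andbT => t0;
  rewrite lee_fin !mulr_ge0// ?exprn_ge0 ?invr_ge0 ?sqrtr_ge0// ltW.
- by rewrite lee_fin divr_ge0//; exact: (mulr_ge0 Km0 Kl0).
rewrite [RHS]integral_mkcond; apply: eq_integral => t _; rewrite patchE.
have -> : (t \in `]0, +oo[%classic) = (0 < t) by apply/idP/idP;
  rewrite inE/= in_itv/= andbT.
case: ifPn => t0; last first.
  rewrite integral0_eq// => p _; rewrite /= /H/= (negbTE t0).
  by rewrite !(mul0r, mulr0).
(* largest p such that (p, p t) lies in the unit disc *)
pose r := (Num.sqrt (1 + t ^+ 2))^-1.
have r0 : 0 < r by rewrite invr_gt0 sqrtr_gt0.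
pose c := \1_B (1 - (1 + t ^+ 2)^-1) * (Km * Kl * t ^+ l.-1).
have c0 : 0 <= c by apply: mulr_ge0 => //; rewrite (mulr_ge0 (mulr_ge0 Km0 Kl0))//
  exprn_ge0// ltW.
transitivity (\int[@lebesgue_measure R]_(p in `]0%R, r])
  (c%:E * (p ^+ (m + l).-1)%:E))%E.
  rewrite [RHS]integral_mkcond; apply: eq_integral => p _; rewrite patchE /= /H/= t0.
  have -> : (p \in `]0, r]%classic) = (0 < p) && (p ^+ 2 * (1 + t ^+ 2) <= 1).
    have E : 0 < p -> (p <= r) = (p ^+ 2 * (1 + t ^+ 2) <= 1).
      move=> p0; rewrite -[1 + t ^+ 2 in RHS]sqr_sqrtr ?(ltW (p1 t))// -exprMn.
      rewrite expr_le1// ?mulr_ge0 ?sqrtr_ge0 ?(ltW p0)//.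
      by rewrite /r -[_^-1]mul1r ler_pdivlMr// sqrtr_gt0.
    apply/idP/andP; rewrite inE /= in_itv/=.
      by move=> /andP[p0 pr]; rewrite -E.
    by move=> [p0]; rewrite -E// p0.
  case: (ltP 0 p) => p0 /=; last by rewrite !mul0r.
  case: ifP => _ /=; last by rewrite !(mulr0, mul0r).
  by rewrite -EFinM; congr EFin; rewrite /c; ring.
rewrite ge0_integralZl//; last 2 first.
- apply/measurable_EFinP; apply: (measurable_funS measurableT) => //;
  exact: exprn_measurable.
- by move=> p /=; rewrite in_itv/= => /andP[p0 _]; rewrite lee_fin exprn_ge0// ltW.
rewrite integral_radial_power// -!EFinM prednK ?addn_gt0 ?m0//; congr EFin.
by rewrite /c /r -/Km -/Kl; ring.
Qed.

(** The densities of [nu] are evaluated at squares only, where the real powers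
    are quotients of integral powers. *)
Lemma powR_half_sub1 (R : realType) k (x : R) : 0 < x ->
  (x ^+ 2) `^ (k%:R / 2 - 1) = x ^+ k / x ^+ 2.
Proof.
move=> x0; rewrite -powR_mulrn ?(ltW x0)// -powRrM mulrBr mulrCA divff// !mulr1.
by rewrite powRD ?powRN ?powR_mulrn ?(ltW x0)// (gt_eqF x0) implybT.
Qed.

Lemma measurable_nu_density (R : realType) n l : measurable_fun [set: R]
  (nu_density n l).
Proof.
apply: measurable_funM; first exact: measurable_powR.
apply: (measurableT_comp (measurable_powR _)); exact: measurable_funB.
Qed.

Lemma nu_density_ge0 (R : realType) n l (s : R) : 0 <= nu_density n l s.
Proof. by rewrite mulr_ge0// powR_ge0. Qed.

Lemma measurable_sqr_ratio_derive (R : realType) :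
  measurable_fun [set: R] (fun t : R => 2 * t / (1 + t ^+ 2) ^+ 2).
Proof.
have mt : measurable_fun [set: R] (fun t : R => (1 + t ^+ 2) ^+ 2).
  apply: (measurableT_comp (exprn_measurable _)).
  by apply: measurable_funD => //; exact: exprn_measurable.
apply: measurable_funM; first exact: measurable_funM.
under eq_fun do rewrite -powR_inv1 ?sqr_ge0//.
exact: (measurableT_comp (measurable_powR (-1)) mt).
Qed.

(** Substitution s = t^2 / (1 + t^2) in the integral that defines [nu]. *)
Lemma integral_nu_density_slope (R : realType) m l (B : set R) : (0 < l)%N ->
  measurable B ->
  (\int[@lebesgue_measure R]_(s in B `&` `[0%R, 1%R]) (nu_density (m + l) l s)%:E =
   2%:E * \int[@lebesgue_measure R]_(t in `]0%R, +oo[)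
     (\1_B (1 - (1 + t ^+ 2)^-1) * (t ^+ l.-1 * (Num.sqrt (1 + t ^+ 2))^-1 ^+
       (m + l)))%:E)%E.
Proof.
move=> l0 mB.
have p1 (t : R) : 0 < 1 + t ^+ 2 by rewrite ltr_wpDr ?sqr_ge0.
pose g (s : R) := \1_B s * nu_density (m + l) l s.
have mg : measurable_fun [set: R] g.
  by apply: measurable_funM; [exact: measurable_indic|exact: measurable_nu_density].
have mh : measurable_fun [set: R] (fun t : R => 1 - (1 + t ^+ 2)^-1).
  exact: continuous_measurable_fun (is_derive_continuous (@is_derive_sqr_ratio R)).
have md := @measurable_sqr_ratio_derive R.
transitivity (\int[@lebesgue_measure R]_(s in `]0%R, 1%R[) (g s)%:E)%E.
  rewrite setIC integral_mkcondr.
  rewrite -(@integral_itv_bndoo _ _ _ (EFin \o g) true false); last first.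
    by apply/measurable_EFinP; exact: measurable_funS mg.
  apply: eq_integral => s _; rewrite patchE /= /g indicE.
  by case: ifPn => _; rewrite ?mul1r ?mul0r.
rewrite (@ge0_integral_pushdens _ _ (measurableTypeR R) (measurableTypeR R) R
  lebesgue_measure lebesgue_measure (fun t : R => 1 - (1 + t ^+ 2)^-1)
  (fun t : R => 2 * t / (1 + t ^+ 2) ^+ 2) `]0, +oo[%classic
  `]0, 1[%classic (EFin \o g)) => //; last 7 first.
- exact: measurable_funS mh.
- exact: measurable_funS md.
- move=> x /=; rewrite in_itv/= andbT => x0.
  by apply: divr_ge0; [rewrite mulr_ge0// ltW|exact: sqr_ge0].
- move=> x /=; rewrite !in_itv/= !andbT => x0.
  by rewrite subr_gt0 invf_lt1// ltrDl exprn_gt0//= gtrBl invr_gt0.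
- move=> A mA A0; have := subst_sqr_ratio mA.
  rewrite setIidl; last by move=> x /A0 /=; rewrite !in_itv/= => /andP[/ltW -> ->].
  move=> h; apply: (etrans h); congr integral; apply/seteqP; split => x /= [];
    rewrite /= !in_itv/= !andbT => x0 Ax; split => //; last exact: ltW.
  have := A0 _ Ax; rewrite /= in_itv/= => /andP[+ _].
  move: x0; rewrite le_eqVlt => /predU1P[<-|//].
  by rewrite expr0n addr0 invr1 subrr ltxx.
- by apply/measurable_EFinP; exact: measurable_funS mg.
- by move=> y _; rewrite lee_fin mulr_ge0 ?nu_density_ge0.
rewrite -ge0_integralZl//; last first.
- by move=> x /=; rewrite in_itv/= andbT => x0;
  rewrite lee_fin !mulr_ge0// ?exprn_ge0 ?invr_ge0 ?sqrtr_ge0// ltW.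
- have ms := @measurable_slope_integrand R B l.-1 (m + l) mB.
  by apply/measurable_EFinP; exact: measurable_funS ms.
apply: eq_integral => t /[!inE] /=; rewrite in_itv/= andbT => t0.
rewrite -!EFinM; congr EFin; rewrite /g -[LHS]mulrA [RHS]mulrCA; congr (_ * _).
rewrite /nu_density addnK.
have [r0 e1 e2] := sqr_ratio_sqrt t.
set r := Num.sqrt (1 + t ^+ 2) in r0 e1 e2 *.
have r2 : 1 + t ^+ 2 = r ^+ 2 by rewrite sqr_sqrtr// ltW.
rewrite e1 e2 {e1 e2}.
rewrite !powR_half_sub1 ?divr_gt0 ?invr_gt0// -/r r2.
have tl : (t : R) ^+ l = t * t ^+ l.-1 by rewrite -exprS prednK.
rewrite !expr_div_n !exprVn exprD tl.
by field; rewrite !expf_neq0 ?gt_eqF.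
Qed.

(** The area is m + l times the volume of the cone; Tonelli over R^m x R^l,
    polar coordinates in both factors and integration along the slopes compute
    this volume. *)
Lemma surface_borel_sparam (R : realType) m l (B : set R) : (0 < m)%N ->
  (0 < l)%N -> measurable B ->
  surface_borel (@sparam R (m + l) l @^-1` B) =
  ((sigma R m.-1 * sigma R l.-1 / 2)%:E *
   \int[@lebesgue_measure R]_(s in B `&` `[0%R, 1%R]) (nu_density (m + l) l s)%:E)%E.
Proof.
move=> m0 l0 mB.
have mS : measurable (@sparam R (m + l) l @^-1` B).
  by rewrite -[X in measurable X]setTI; exact: measurable_sparam.
have mcone := measurable_sphere_cone mS.
rewrite /surface_borel -[sphere_cone _]setIT -integral_indic//.
rewrite integral_lebesgue_cV_col; last 2 first.
- by apply/measurable_EFinP; exact: measurable_indic.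
- by move=> x; rewrite lee_fin.
have coneC (x : 'cV[R]_m) (y : 'cV[R]_l) :
  \1_(sphere_cone (@sparam R (m + l) l @^-1` B)) (col_mx x y) = \1_(slope_sector B)
    (enorm x, enorm y) :> R.
  rewrite !indicE; congr (_ %:R); congr nat_of_bool; apply/idP/idP;
    rewrite !inE sphere_coneE /slope_sector/=.
    move=> [/=]; rewrite in_itv/= => /andP[z0 z1].
    rewrite sparamZ sparam_col_mx -enorm_col_mx exprVn -sqr_enorm mulrC => Bz;
      split => //.
    by rewrite exprn_gt0//= expr_le1// enorm_ge0.
  rewrite -enorm_col_mx => -[/andP[z0 z1] Bz]; split => /=.
    rewrite in_itv/= -(expr_le1 (ltn0Sn 1) (enorm_ge0 _)) z1 andbT.
    by rewrite lt_def enorm_ge0 andbT; move: z0; apply: contraTneq => ->;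
      rewrite expr0n ltxx.
  by rewrite sparamZ sparam_col_mx exprVn -sqr_enorm mulrC.
under eq_integral do under eq_integral do rewrite coneC.
rewrite (@integral_two_enorms R m l (fun u => (\1_(slope_sector B) u)%:E))//;
  last first.
  by apply/measurable_EFinP; apply: measurable_indic; exact: measurable_slope_sector.
rewrite (integral_slope m0 l0 mB) (integral_nu_density_slope m l0 mB) !muleA
  -!EFinM; congr (_%:E * _)%E.
rewrite -[in RHS]sigma_ball_volume -[in RHS]sigma_ball_volume !prednK//.
by field; rewrite -natrD pnatr_eq0 -lt0n addn_gt0 m0.
Qed.

(** * Completed measures *)

Lemma measure_sandwich d (T : measurableType d) (R : realType)
    (m : {measure set T -> \bar R}) (X A B : set T) :
  measurable X -> measurable A -> measurable B -> X `<=` A -> A `<=` X `|` B ->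
  m B = 0%E -> m A = m X.
Proof.
move=> mX mA mB XA AXB B0; apply/eqP; rewrite eq_le; apply/andP; split.
  rewrite (@le_trans _ _ (m (X `|` B)))//.
    by rewrite le_measure ?inE//; exact: measurableU.
  by rewrite (le_trans (measureU2 _ mX mB))// [X in (_ + X)%E]B0 adde0.
by rewrite le_measure ?inE.
Qed.

Section completion.
Local Open Scope ereal_scope.
Context d (T : measurableType d) (R : realType).
Context (mu : {measure set T -> \bar R}).

Lemma cara_measurable (A : set T) : measurable A -> (mu^*)%mu.-cara.-measurable A.
Proof. exact: caratheodory_measurable_mu_ext. Qed.

(** Caratheodory measurability contains the subsets of Borel null sets. *)
Lemma cara_negligible (N B : set T) : measurable B -> mu B = 0 -> N `<=` B ->
  (mu^*)%mu.-cara.-measurable N.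
Proof.
move=> mB B0 NB; apply: measure_is_complete_caratheodory.
exists B; split => //; first exact: cara_measurable.
by rewrite /= measurable_mu_extE.
Qed.

(** Intersection of measurable covers whose measures tend to the outer measure
    of [E]. *)
Lemma measurable_hull (E : set T) : mu setT < +oo ->
  exists F, [/\ measurable F, E `<=` F & mu F = (mu^*)%mu E].
Proof.
move=> muT.
have fE : (mu^*)%mu E \is a fin_num.
  rewrite ge0_fin_numE ?mu_ext_ge0// (le_lt_trans _ muT)//.
  by rewrite -(@measurable_mu_extE _ _ _ mu setT)//; exact: le_mu_ext.
have cover k : exists F, [/\ measurable F, E `<=` F & mu F <= (mu^*)%mu E +
  k.+1%:R^-1%:E].
  have k0 : (0 < k.+1%:R^-1 :> R)%R by rewrite invr_gt0.
  have [_ [A [mA EA] <-] lt] := lb_ereal_inf_adherent k0 fE.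
  exists (\bigcup_i A i); split => //; first exact: bigcupT_measurable.
  apply: (le_trans _ (ltW lt)).
  apply: measure_sigma_subadditive => //; exact: bigcupT_measurable.
have [F FP] := choice cover.
have mF : measurable (\bigcap_k F k) by apply: bigcapT_measurable => k; have [] := FP k.
have EF : E `<=` \bigcap_k F k by move=> x Ex k _; have [_ + _] := FP k; exact.
exists (\bigcap_k F k); split => //.
apply/eqP; rewrite eq_le; apply/andP; split; last first.
  by rewrite -(measurable_mu_extE mu mF); exact: le_mu_ext.
apply/lee_addgt0Pr => e e0.
have [k ke] : exists k : nat, (k.+1%:R^-1 <= e)%R.
  exists (Num.truncn e^-1); rewrite -[e]invrK lef_pV2 ?posrE ?invr_gt0// invrK.
  exact/ltW/truncnS_gt.
have [mFk _ muFk] := FP k.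
apply: (@le_trans _ _ (mu (F k))); first by rewrite le_measure ?inE//;
  exact: bigcap_inf.
by rewrite (le_trans muFk)// leeD2l// lee_fin.
Qed.

(** [B] is a hull of [E], and [A] is [B] minus a hull of [B] minus [E], which is
    null because [E] splits the outer measure of [B]. *)
Lemma cara_sandwich (E : set T) : mu setT < +oo -> (mu^*)%mu.-cara.-measurable E ->
  exists A B, [/\ measurable A, measurable B, A `<=` E, E `<=` B & mu (B `\` A) = 0].
Proof.
move=> muT cE.
have [F [mF EF muF]] := measurable_hull E muT.
have [G [mG FEG muG]] := measurable_hull (F `\` E) muT.
have fF : mu F \is a fin_num.
  by rewrite ge0_fin_numE// (le_lt_trans _ muT)// le_measure ?inE.
have G0 : mu G = 0.
  have : (mu^*)%mu F = (mu^*)%mu (F `&` E) + (mu^*)%mu (F `&` ~` E) := cE F.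
  rewrite (setIidr EF) (measurable_mu_extE mu mF) -muF -setDE -muG.
  by move=> /eqP; rewrite addeC -sube_eq ?ge0_adde_def ?inE// subee// => /eqP.
exists (F `\` G), F; split => //; first exact: measurableD.
- by move=> x [Fx nGx]; apply: contrapT => nEx; apply: nGx; exact: FEG.
- rewrite setDD; apply/eqP; rewrite -measure_le0 -G0 le_measure ?inE//.
  exact: measurableI.
Qed.

End completion.

Lemma lebesgue_caraP (R : realType) (A : set R) :
  ((@wlength R idfun)^*)%mu.-cara.-measurable A <->
  exists X N B : set R, [/\ measurable X, measurable B, lebesgue_measure B = 0%E,
     N `<=` B & A = X `|` N].
Proof.
rewrite -completed_caratheodory_measurable g_sigma_completed_algebra_genE; split.
  move=> [/= X mX [N [B [mB B0 NB]] <-]].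
  by exists X, N, B.
move=> [X [N [B [mX mB B0 NB ->]]]]; exists X => //.
by exists N => //; exists B.
Qed.

Notation lebesgueT R := (caratheodory_type (@wlength R idfun)^*%mu).
Notation sphereT R n := (caratheodory_type (@surface_borel R n)^*%mu).

Lemma lebesgue_cara_measurable (R : realType) (A : set R) : measurable A ->
  measurable (A : set (lebesgueT R)).
Proof. exact: sub_caratheodory. Qed.

Lemma lebesgue_cara_measurable_fun (R : realType) d (U : measurableType d)
  (g : R -> U) :
  measurable_fun [set: R] g -> measurable_fun [set: lebesgueT R] (g : lebesgueT R -> U).
Proof. by move=> mg _ A mA; apply: lebesgue_cara_measurable; exact: mg. Qed.

(** Completion does not change the integrals of Borel functions. *)
Lemma ge0_integral_completed (R : realType) (D : set R) (g : R -> \bar R) :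
  measurable D -> measurable_fun [set: R] g -> (forall x, 0 <= g x)%E ->
  (\int[@completed_lebesgue_measure R]_(x in D) g x = \int[@lebesgue_measure
    R]_(x in D) g x)%E.
Proof.
move=> mD mg g0; apply/esym.
rewrite (@ge0_integral_pushdens _ _ (lebesgueT R) (measurableTypeR R) R
  (@completed_lebesgue_measure R) (@lebesgue_measure R) id (cst 1) D D g)//.
- by apply: eq_integral => x _; rewrite mule1.
- exact: lebesgue_cara_measurable.
- by apply: measurable_funTS; exact: (@lebesgue_cara_measurable_fun R _ R).
- move=> A mA AD; rewrite preimage_id (setIidr AD) (eq_integral (cst 1%:E))//.
  by rewrite integral_cst ?mul1e//; exact: lebesgue_cara_measurable.
- exact: measurable_funS mg.
Qed.

Lemma nu_borel (R : realType) n l (B : set R) : measurable B ->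
  nu R n l B = (\int[@lebesgue_measure R]_(s in B `&` `[0%R, 1%R])
    (nu_density n l s)%:E)%E.
Proof.
move=> mB; apply: ge0_integral_completed.
- exact: measurableI.
- by apply/measurable_EFinP; exact: measurable_nu_density.
- by move=> x; rewrite lee_fin nu_density_ge0.
Qed.

Lemma nu_null (R : realType) n l (B : set R) : measurable B ->
  lebesgue_measure B = 0%E ->
  nu R n l B = 0%E.
Proof.
move=> mB B0; rewrite nu_borel//; have := @integral_abs_eq0 _ _ R (@lebesgue_measure R)
  (B `&` `[0%R, 1%R]) (fun s => (nu_density n l s)%:E) _ _ _.
under eq_integral do rewrite gee0_abs ?lee_fin ?nu_density_ge0//.
apply.
- exact: measurableI.
- apply: (@measurable_funTS _ _ (measurableTypeR R)).
  have : measurable_fun [set: R] (fun s : R => (nu_density n l s)%:E).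
    by apply/measurable_EFinP; exact: measurable_nu_density.
  exact.
- apply/eqP; rewrite -measure_le0 -B0 le_measure ?inE//; exact: measurableI.
Qed.

Lemma ball_volume_gt0 (R : realType) n : (0 < n)%N -> 0 < ball_volume R n.
Proof.
move=> n0; rewrite lt_def ball_volume_ge0 andbT; apply/negP => /eqP v0.
have := integral_gauss_cV R n.
under eq_integral do rewrite -sqr_enorm.
rewrite (@integral_enormT R n (fun p => (expR (- p ^+ 2))%:E))//; last first.
  by apply/measurable_EFinP; exact: measurable_gauss_fun.
rewrite integral0_eq; last first.
  by move=> x _; rewrite /radial_density v0 mulr0 mul0r mulr0 mule0.
move=> [] /esym /eqP; rewrite expf_eq0 n0 /= gt_eqF//.
by rewrite sqrtr_gt0 pi_gt0.
Qed.

Lemma sigma_gt0 (R : realType) n : 0 < sigma R n.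
Proof. by rewrite -sigma_ball_volume mulr_gt0// ball_volume_gt0. Qed.

Lemma measurable_unit_sphere (R : realType) n : measurable (@unit_sphere R n).
Proof.
rewrite (_ : unit_sphere = setT `&` @enorm R n @^-1` [set 1]); last by rewrite setTI.
exact: measurable_enorm.
Qed.

(** The cones only see the part of a set that lies on the sphere. *)
Lemma surface_borelI (R : realType) n (A : set 'cV[R]_n) :
  surface_borel (unit_sphere `&` A) = surface_borel A.
Proof. by rewrite /surface_borel /sphere_cone setIAC setIid setIC. Qed.

(** * Integrals of functions of s *)

Section sparam_completed.
Context (R : realType) (m l : nat) (m0 : (0 < m)%N) (l0 : (0 < l)%N).
Let n := (m + l)%N.
Let K : R := sigma R m.-1 * sigma R l.-1 / 2.

Lemma surface_const_gt0 : 0 < K.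
Proof. by rewrite divr_gt0// mulr_gt0// sigma_gt0. Qed.

Lemma surface_borel_sparam_nu (B : set R) : measurable B ->
  surface_borel (unit_sphere `&` @sparam R n l @^-1` B) = (K%:E * nu R n l B)%E.
Proof. by move=> mB; rewrite surface_borelI surface_borel_sparam// nu_borel. Qed.

Lemma sparam_borel (B : set R) : measurable B ->
  measurable (unit_sphere `&` @sparam R n l @^-1` B).
Proof.
move=> mB; apply: measurableI; first exact: measurable_unit_sphere.
by rewrite -[X in measurable X]setTI; exact: measurable_sparam.
Qed.

(** A Lebesgue measurable set is a Borel set up to a subset of a Borel null set,
    and Borel null sets pull back to sets of area zero. *)
Lemma sparam_completed (A : set (lebesgueT R)) : measurable A ->
  measurable (unit_sphere `&` @sparam R n l @^-1` A : set (sphereT R n)) /\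
  surface_measure R n (unit_sphere `&` @sparam R n l @^-1` A) = (K%:E * nu R n l A)%E.
Proof.
move=> mA; have := mA; move=> /lebesgue_caraP[X [N [B [mX mB B0 NB AXN]]]].
have mSX := cara_measurable (@surface_borel R n) (sparam_borel mX).
have mSB := cara_measurable (@surface_borel R n) (sparam_borel mB).
have SB0 : surface_borel (unit_sphere `&` @sparam R n l @^-1` B) = 0%E.
  by rewrite surface_borel_sparam_nu// nu_null// mule0.
have mSA : measurable (unit_sphere `&` @sparam R n l @^-1` A : set (sphereT R n)).
  rewrite AXN preimage_setU setIUr; apply: measurableU => //.
  apply: (cara_negligible (sparam_borel mB) SB0).
  by move=> t [St Nt]; split => //; exact: NB.
split => //.
rewrite (@measure_sandwich _ _ _ (nu R n l) X A B)//; last 5 first.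
- exact: lebesgue_cara_measurable.
- exact: lebesgue_cara_measurable.
- by rewrite AXN; exact: subsetUl.
- by rewrite AXN; exact: setUS.
- exact: nu_null.
rewrite -surface_borel_sparam_nu//.
rewrite -(@measurable_mu_extE _ _ _ (@surface_borel R n))//; last exact: sparam_borel.
apply: (@measure_sandwich _ _ _ (surface_measure R n) _ _ (unit_sphere `&` @sparam R
  n l @^-1` B)) => //.
- by rewrite AXN => t [St Xt]; split => //; left.
- by rewrite AXN => t [St [Xt|Nt]]; [left|right]; split => //; exact: NB.
- by rewrite -SB0 -(@measurable_mu_extE _ _ _ (@surface_borel R n))//;
  exact: sparam_borel.
Qed.

Lemma measurable_fun_sparam :
  measurable_fun (unit_sphere : set (sphereT R n)) (@sparam R n l : sphereT R n ->
    lebesgueT R).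
Proof. by move=> _ A mA; have [] := sparam_completed mA. Qed.

End sparam_completed.

Lemma integral0_null d (T : measurableType d) (R : realType)
  (mu : {measure set T -> \bar R})
    (D : set T) (f : T -> \bar R) :
  measurable D -> measurable_fun D f -> (forall x, D x -> (0 < f x)%E) ->
  (\int[mu]_(x in D) f x = 0)%E -> mu D = 0%E.
Proof.
move=> mD mf f0 int0.
have : ae_eq mu D f (cst 0%E).
  apply/ae_eq_integral_abs => //.
  by rewrite -[RHS]int0; apply: eq_integral => x /[!inE] Dx;
    rewrite /= gee0_abs// ltW// f0.
move=> [N [mN N0 DN]]; apply/eqP; rewrite -measure_le0 -N0 le_measure ?inE// => x Dx.
by apply: DN => /= /(_ Dx) fx0; have := f0 _ Dx; rewrite fx0 ltxx.
Qed.

Lemma integral_sandwich d (T : measurableType d) (R : realType)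
  (mu : {measure set T -> \bar R})
    (X A B : set T) (f : T -> \bar R) :
  measurable X -> measurable A -> measurable B -> X `<=` A -> A `<=` X `|` B ->
  mu B = 0%E -> measurable_fun A f -> (forall x, A x -> (0 <= f x)%E) ->
  (\int[mu]_(x in A) f x = \int[mu]_(x in X) f x)%E.
Proof.
move=> mX mA mB XA AXB B0 mf f0.
rewrite (ge0_negligible_integral mB mA)// [RHS](ge0_negligible_integral mB mX)//;
  last 2 first.
- exact: measurable_funS mf.
- by move=> x /XA; exact: f0.
congr integral; apply/seteqP; split => x [? nB]; split => //; last exact: XA.
by have [] := AXB x.
Qed.

Lemma sparam_itv (R : realType) m l (t : 'cV[R]_(m + l)) : unit_sphere t ->
  0 <= sparam l t <= 1.
Proof.
rewrite -[t]vsubmxK sparam_col_mx /unit_sphere/= => /(congr1 (fun x => x ^+ 2)).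
by rewrite enorm_col_mx expr1n -sqr_enorm => <-; rewrite lerDr !sqr_ge0.
Qed.

Lemma integral_sparam (R : realType) m l (g : lebesgueT R -> \bar R) :
  (0 < m)%N -> (0 < l)%N ->
  measurable_fun (`[0, 1]%classic : set (lebesgueT R)) g ->
  (forall s, `[0, 1]%classic s -> (0 <= g s)%E) ->
  (\int[surface_measure R (m + l)]_(t in unit_sphere) g (sparam l t) =
   (sigma R m.-1 * sigma R l.-1 / 2)%:E * \int[nu R (m + l) l]_(s in `[0%R,
     1%R]) g s)%E.
Proof.
move=> m0 l0 mg g0; set K := _ / 2; have K0 : 0 < K := surface_const_gt0 R m l.
have mI : measurable (`[0, 1]%classic : set (lebesgueT R))
  by exact: lebesgue_cara_measurable.
have mS : measurable (unit_sphere : set (sphereT R (m + l))).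
  by apply: cara_measurable; exact: measurable_unit_sphere.
rewrite (@ge0_integral_pushdens _ _ (sphereT R (m + l)) (lebesgueT R) R
  (surface_measure R (m + l)) (nu R (m + l) l) (@sparam R (m + l) l) (cst K^-1)
    unit_sphere
  `[0%R, 1%R]%classic g) => //; last 4 first.
- exact: measurable_fun_sparam.
- by move=> x _; rewrite invr_ge0 ltW.
- by move=> t /sparam_itv; rewrite /= in_itv.
- move=> A mA _; have [mSA SAE] := @sparam_completed R m l m0 l0 A mA.
  rewrite (eq_integral (cst K^-1%:E))// integral_cst// [X in (_ * X)%E]SAE.
  by rewrite muleA -EFinM mulVf ?mul1e// gt_eqF.
have mgs : measurable_fun (unit_sphere : set (sphereT R (m + l)))
  (fun t => g (sparam l t)).
  apply: (measurable_comp mI _ mg (@measurable_fun_sparam R m l m0 l0)).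
  by move=> _ [t /sparam_itv + <-]; rewrite /= in_itv.
rewrite /cst ge0_integralZr//; last 2 first.
- by move=> t St; apply: g0; rewrite /= in_itv; exact: sparam_itv.
- by rewrite lee_fin invr_ge0 ltW.
by rewrite muleC -muleA -EFinM mulVf ?mule1// gt_eqF.
Qed.

(** The density of [nu] in the variable w with s = cos^2 w. *)
Definition angle_density (R : realType) m l (w : R) : R :=
  2 * (sin w ^+ m.-1 * cos w ^+ l.-1).

Lemma sin_cos_ge0 (R : realType) (w : R) : 0 <= w <= pi / 2 -> 0 <= sin w /\ 0 <= cos w.
Proof.
move=> /andP[w0 w1]; split.
  by rewrite sin_ge0_pi// w0 (le_trans w1)// ler_pdivrMr// ler_peMr// ?pi_ge0// ler1n.
by rewrite cos_ge0_pihalf// w1 (le_trans _ w0)// oppr_le0 divr_ge0// pi_ge0.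
Qed.

Lemma sin_cos_gt0 (R : realType) (w : R) : 0 < w < pi / 2 -> 0 < sin w /\ 0 < cos w.
Proof.
move=> /andP[w0 w1]; split; first by rewrite sin_gt0_pihalf// w0.
by rewrite cos_gt0_pihalf// w1 (le_lt_trans _ w0)// oppr_le0 divr_ge0// pi_ge0.
Qed.

Lemma sqr_cos_itvoo (R : realType) (w : R) : 0 < w < pi / 2 -> 0 < cos w ^+ 2 < 1.
Proof.
move=> /sin_cos_gt0[s0 c0]; rewrite exprn_gt0//=.
by rewrite -[ltRHS](cos2Dsin2 w) ltrDl exprn_gt0.
Qed.

Lemma measurable_sqr_cos (R : realType) : measurable_fun [set: R]
  (fun w : R => cos w ^+ 2).
Proof.
exact: (measurableT_comp (exprn_measurable 2) (continuous_measurable_fun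
  (@continuous_cos R))).
Qed.

Lemma measurable_angle_density (R : realType) m l : measurable_fun [set: R]
  (@angle_density R m l).
Proof.
apply: measurable_funM => //; apply: measurable_funM.
  exact: (measurableT_comp (exprn_measurable _) (continuous_measurable_fun
    (@continuous_sin R))).
exact: (measurableT_comp (exprn_measurable _) (continuous_measurable_fun
  (@continuous_cos R))).
Qed.

Lemma angle_density_ge0 (R : realType) m l (w : R) : 0 <= w <= pi / 2 -> 0 <=
  angle_density m l w.
Proof. by move=> /sin_cos_ge0[s0 c0]; rewrite mulr_ge0// mulr_ge0// exprn_ge0. Qed.

Lemma nu_borel_angle (R : realType) m l (B : set R) : (0 < m)%N -> (0 < l)%N ->
  measurable B ->
  nu R (m + l) l B =
  (\int[@lebesgue_measure R]_(w in `[0%R, (pi / 2)%R] `&`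
    (fun w => cos w ^+ 2)%R @^-1` B)
    (angle_density m l w)%:E)%E.
Proof.
move=> m0 l0 mB; rewrite nu_borel//.
pose g (s : R) := \1_B s * nu_density (m + l) l s.
have mg : measurable_fun [set: R] g.
  by apply: measurable_funM; [exact: measurable_indic|exact: measurable_nu_density].
have mcs : measurable_fun [set: R] (fun t : R => 2 * sin t * cos t).
  apply: measurable_funM; last exact: (continuous_measurable_fun (@continuous_cos R)).
  by apply: measurable_funM => //;
    exact: (continuous_measurable_fun (@continuous_sin R)).
have mcB : measurable ((fun w : R => cos w ^+ 2) @^-1` B).
  by rewrite -[X in measurable X]setTI; exact: measurable_sqr_cos.
transitivity (\int[@lebesgue_measure R]_(s in `]0%R, 1%R[) (g s)%:E)%E.
  rewrite setIC integral_mkcondr.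
  rewrite -(@integral_itv_bndoo _ _ _ (EFin \o g) true false); last first.
    by apply/measurable_EFinP; exact: measurable_funS mg.
  apply: eq_integral => s _; rewrite patchE /= /g indicE.
  by case: ifPn => _; rewrite ?mul1r ?mul0r.
rewrite (@ge0_integral_pushdens _ _ (measurableTypeR R) (measurableTypeR R) R
  lebesgue_measure lebesgue_measure (fun t : R => cos t ^+ 2)
  (fun t : R => 2 * sin t * cos t) `]0, (pi / 2)[%classic
  `]0, 1[%classic (EFin \o g)) => //; last 7 first.
- by apply: (@measurable_funTS _ _ (measurableTypeR R)); exact: measurable_sqr_cos.
- by apply: (@measurable_funTS _ _ (measurableTypeR R)); exact: mcs.
- by move=> x /=; rewrite in_itv/= => /sin_cos_gt0[? ?]; rewrite !mulr_ge0// ltW.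
- by move=> x /=; rewrite !in_itv/=; exact: sqr_cos_itvoo.
- move=> A mA A0; have := subst_sqr_cos mA.
  rewrite setIidl; last by move=> x /A0 /=; rewrite !in_itv/= => /andP[/ltW -> /ltW ->].
  move=> h; apply: (etrans h); congr integral; apply/seteqP; split => x /= [];
    rewrite /= !in_itv/= => /andP[x0 x1] Ax; split => //; last by rewrite !ltW.
  have := A0 _ Ax; rewrite /= in_itv/= !lt_neqAle x0 x1 !andbT => /andP[c0 c1].
  apply/andP; split; apply/eqP => xE.
    by move: c1; rewrite -xE cos0 expr1n eqxx.
  by move: c0; rewrite xE cos_pihalf expr0n eqxx.
- by apply/measurable_EFinP; exact: measurable_funS mg.
- by move=> y _; rewrite lee_fin mulr_ge0 ?nu_density_ge0.
have mad : measurable_fun [set: R]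
    ((fun w => (angle_density m l w)%:E) \_ ((fun w : R => cos w ^+ 2) @^-1` B)).
  have ma : measurable_fun [set: R] (fun w => (@angle_density R m l w)%:E).
    by apply/measurable_EFinP; exact: measurable_angle_density.
  exact: ((measurable_restrictT _ mcB).1 (measurable_funTS ma)).
rewrite integral_mkcondr [RHS]integral_itv_bndoo; last exact: measurable_funS mad.
apply: eq_integral => w /[!inE] /=; rewrite in_itv/= => w01.
have [s0 c0] := sin_cos_gt0 w01.
rewrite patchE /g indicE /=.
have -> : (w \in (fun w : R => cos w ^+ 2) @^-1` B) = (cos w ^+ 2 \in B).
  by apply/idP/idP; rewrite !inE.
case: ifPn => _; rewrite ?mul0r ?mul0e// mul1r -EFinM; congr EFin.
rewrite /nu_density addnK -sin2cos2 !powR_half_sub1// /angle_density.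
have -> : cos w ^+ l = cos w * cos w ^+ l.-1 by rewrite -exprS prednK.
have -> : sin w ^+ m = sin w * sin w ^+ m.-1 by rewrite -exprS prednK.
by field; rewrite !gt_eqF.
Qed.

(** The derivative of the substitution does not vanish inside the segment. *)
Lemma sqr_cos_null (R : realType) (B : set R) : measurable B ->
  lebesgue_measure B = 0%E ->
  lebesgue_measure (`[0%R, (pi / 2)%R] `&` (fun w => cos w ^+ 2)%R @^-1` B) = 0%E.
Proof.
move=> mB B0.
have mcB : measurable ((fun w : R => cos w ^+ 2) @^-1` B).
  by rewrite -[X in measurable X]setTI; exact: measurable_sqr_cos.
have mcs : measurable_fun [set: R] (fun t : R => 2 * sin t * cos t).
  apply: measurable_funM; last exact: (continuous_measurable_fun (@continuous_cos R)).
  by apply: measurable_funM => //;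
    exact: (continuous_measurable_fun (@continuous_sin R)).
pose D := `]0%R, (pi / 2)%R[%classic `&` (fun w : R => cos w ^+ 2) @^-1` B.
have mD : measurable D by exact: measurableI.
have D0 : lebesgue_measure D = 0%E.
  apply: (@integral0_null _ (measurableTypeR R) R lebesgue_measure D
    (fun t => (2 * sin t * cos t)%:E)).
  - exact: mD.
  - by apply/measurable_EFinP; apply: (@measurable_funTS _ _ (measurableTypeR R));
    exact: mcs.
  - by move=> w [/=]; rewrite in_itv/= => /sin_cos_gt0[? ?] _;
    rewrite lte_fin !mulr_gt0.
  apply/eqP; rewrite eq_le integral_ge0 ?andbT; last first.
    by move=> w [/=]; rewrite in_itv/= => /sin_cos_gt0[? ?] _;
      rewrite lee_fin ltW// !mulr_gt0.
  have <- : lebesgue_measure (B `&` `[0%R, 1%R]) = 0%E.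
    apply/eqP; rewrite -measure_le0 -B0 le_measure ?inE//; exact: measurableI.
  rewrite subst_sqr_cos// ge0_subset_integral//.
  - by apply: measurableI.
  - by apply/measurable_EFinP; exact: measurable_funS mcs.
  - by move=> w [/=]; rewrite in_itv/= => /sin_cos_ge0[? ?] _;
    rewrite lee_fin !mulr_ge0.
  - by move=> w [/= + ?]; rewrite !in_itv/= => /andP[/ltW -> /ltW ->].
have fin0 : lebesgue_measure ([set 0; pi / 2] : set R) = 0%E.
  by apply: countable_lebesgue_measure0; exact: finite_set_countable.
have m2 : measurable ([set 0; pi / 2] : set R) by exact: measurableU.
rewrite (@measure_sandwich _ _ _ lebesgue_measure D _ [set 0; pi / 2])//.
- by apply: measurableI.
- by move=> w [/= + ?]; rewrite !in_itv/= => /andP[/ltW -> /ltW ->].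
move=> w [/= + Bw]; rewrite in_itv/= => /andP[].
rewrite le_eqVlt => /predU1P[<- _|w0]; first by right; left.
rewrite le_eqVlt => /predU1P[->|w1]; first by right; right.
by left; split => //=; rewrite in_itv/= w0.
Qed.

Lemma sqr_cos_completed (R : realType) m l (A : set (lebesgueT R)) : (0 < m)%N ->
  (0 < l)%N ->
  measurable A ->
  measurable (`[0%R, (pi / 2)%R] `&` (fun w => cos w ^+ 2)%R @^-1` A : set
    (lebesgueT R)) /\
  nu R (m + l) l A = (\int[@completed_lebesgue_measure R]_(w in `[0%R, (pi / 2)%R] `&`
    (fun w => cos w ^+ 2)%R @^-1` A) (angle_density m l w)%:E)%E.
Proof.
move=> m0 l0 mA; have := mA; move=> /lebesgue_caraP[X [N [B [mX mB B0 NB AXN]]]].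
pose S (Z : set R) := `[0%R, (pi / 2)%R]%classic `&` (fun w : R => cos w ^+ 2) @^-1` Z.
have mS Z : measurable Z -> measurable (S Z).
  by move=> mZ; apply: measurableI => //; rewrite -[X in measurable X]setTI;
    exact: measurable_sqr_cos.
have mSc Z : measurable Z -> measurable (S Z : set (lebesgueT R)).
  by move=> mZ; apply: lebesgue_cara_measurable; exact: mS.
have mSA : measurable (S A : set (lebesgueT R)).
  apply/lebesgue_caraP; exists (S X), (S N), (S B); split.
  - exact: mS.
  - exact: mS.
  - exact: sqr_cos_null.
  - by move=> w [? ?]; split => //; exact: NB.
  - by rewrite /S AXN preimage_setU setIUr.
split => //.
have mad := @lebesgue_cara_measurable_fun R _ _ _ (@measurable_angle_density R m l).
rewrite (@measure_sandwich _ _ _ (nu R (m + l) l) X A B)//; last 5 first.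
- exact: lebesgue_cara_measurable.
- exact: lebesgue_cara_measurable.
- by rewrite AXN; exact: subsetUl.
- by rewrite AXN; exact: setUS.
- exact: nu_null.
transitivity (\int[@lebesgue_measure R]_(w in S X) (angle_density m l w)%:E)%E.
  exact: nu_borel_angle.
transitivity (\int[@completed_lebesgue_measure R]_(w in S X)
  (angle_density m l w)%:E)%E.
  pose h w := `|@angle_density R m l w|%:E.
  transitivity (\int[@lebesgue_measure R]_(w in S X) h w)%E.
    by apply: eq_integral => w /[!inE] -[/=]; rewrite in_itv => w01 _;
      rewrite /h ger0_norm// angle_density_ge0.
  have mh : measurable_fun [set: R] h.
    by apply/measurable_EFinP; apply: measurableT_comp => //;
      exact: measurable_angle_density.
  rewrite -(ge0_integral_completed (mS _ mX) mh); last by move=> w; rewrite lee_fin.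
  by apply: eq_integral => w /[!inE] -[/=]; rewrite in_itv => w01 _;
    rewrite /h ger0_norm// angle_density_ge0.
apply/esym; apply: (@integral_sandwich _ (lebesgueT R) R
  (@completed_lebesgue_measure R) (S X) (S A) (S B)).
- exact: mSc.
- exact: mSA.
- exact: mSc.
- by rewrite AXN => w [? ?]; split => //; left.
- by rewrite AXN => w [? [?|?]]; [left|right]; split => //; exact: NB.
- exact: sqr_cos_null.
- by apply/measurable_EFinP; exact: measurable_funS mad.
- by move=> w [/= + _]; rewrite in_itv => w01; rewrite lee_fin angle_density_ge0.
Qed.

(** Same transport as for the sphere, along cos^2 instead of the parameter s. *)
Lemma integral_angle (R : realType) m l (g : lebesgueT R -> \bar R) :
  (0 < m)%N -> (0 < l)%N ->
  measurable_fun (`[0, 1]%classic : set (lebesgueT R)) g ->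
  (forall s, `[0, 1]%classic s -> (0 <= g s)%E) ->
  (\int[nu R (m + l) l]_(s in `[0%R, 1%R]) g s =
   \int[@completed_lebesgue_measure R]_(w in `[0%R, (pi / 2)%R])
     (g (cos w ^+ 2)%R * (angle_density m l w)%:E))%E.
Proof.
move=> m0 l0 mg g0.
have mad := @lebesgue_cara_measurable_fun R _ _ _ (@measurable_angle_density R m l).
apply: (@ge0_integral_pushdens _ _ (lebesgueT R) (lebesgueT R) R
  (@completed_lebesgue_measure R) (nu R (m + l) l) (fun w => cos w ^+ 2)
    (angle_density m l)
  `[0%R, (pi / 2)%R]%classic `[0%R, 1%R]%classic g _ _ _ _ _ _ _ mg g0).
- exact: lebesgue_cara_measurable.
- exact: lebesgue_cara_measurable.
- by move=> _ A mA; have [] := @sqr_cos_completed R m l A m0 l0 mA.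
- exact: measurable_funTS mad.
- by move=> w; rewrite /= in_itv/=; exact: angle_density_ge0.
- move=> w _; rewrite /= in_itv/= sqr_ge0/=.
  by rewrite -(cos2Dsin2 w) lerDl sqr_ge0.
- by move=> A mA _; have [] := @sqr_cos_completed R m l A m0 l0 mA.
Qed.

(** * Measurability descends from the sphere to the parameter *)

Lemma surface_borel_lty (R : realType) n : (@surface_borel R n setT < +oo)%E.
Proof.
rewrite /surface_borel lte_mul_pinfty ?lee_fin//.
apply: le_lt_trans (lebesgue_cV_ball_lty R n); rewrite le_measure ?inE//.
- exact: measurable_sphere_cone.
- exact: measurable_enorm_le.
- by move=> _ [r /andP[r0 r1] [t [_ St] <-]] /=;
  rewrite (enormZ _ (ltW r0)) [enorm t]St mulr1.
Qed.

Lemma lebesgue_cV_enorm_gt0 (R : realType) n : (0 < n)%N ->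
  (0 < lebesgue_cV R n [set z | (0 < enorm z)%R])%E.
Proof.
move=> n0.
have mP := @measurable_enorm_gt0 R n.
rewrite lt_neqAle measure_ge0 andbT; apply/eqP => P0.
have := @lebesgue_cV_ball R n 1 (@ltr01 R); rewrite expr1n mul1r.
move=> /eqP; apply/negP; rewrite lt_eqF//.
apply: (@le_lt_trans _ _ 0%E); last by rewrite lte_fin ball_volume_gt0.
have := @measureU2 _ _ _ (lebesgue_cV R n) _ _ (@measurable_enorm_le R n 0) mP.
rewrite [X in (_ <= X + _)%E](lebesgue_cV_ball0 R n0) [X in (_ <= _ + X)%E](esym P0)
  adde0; apply: le_trans.
rewrite le_measure ?inE//; first exact: measurable_enorm_le.
  by apply: measurableU => //; exact: measurable_enorm_le.
by move=> z _ /=; case: (leP (enorm z) 0) => ?; [left|right].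
Qed.

(** For each t > 0 the map (x, y) |-> (x, t y) preserves null sets, so the set
    of pairs (t, z) sent into [Z] is null, and by Tonelli almost every
    z = (x, y) has a null set of times t. The z with nonzero components do not
    form a null set, so that one of them can be taken. *)
Lemma exists_null_ray (R : realType) m l (Z : set 'cV[R]_(m + l)) : (0 < m)%N ->
  (0 < l)%N ->
  measurable Z -> lebesgue_cV R (m + l) Z = 0%E ->
  exists (x : 'cV[R]_m) (y : 'cV[R]_l), [/\ 0 < enorm x, 0 < enorm y,
    measurable [set t : R | 0 < t /\ Z (col_mx x (t *: y))] &
    lebesgue_measure [set t : R | 0 < t /\ Z (col_mx x (t *: y))] = 0%E].
Proof.
move=> m0 l0 mZ Z0.
(* D (t, (x, y)) = (x, t y) *)
pose D (u : measurableTypeR R * 'cV[R]_(m + l)) : 'cV[R]_(m + l) :=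
  col_mx (usubmx u.2) ((u.1 : R) *: dsubmx u.2).
have mus : measurable_fun [set: 'cV[R]_(m + l)] (fun z => usubmx z : 'cV[R]_m).
  by apply: measurable_fun_cV => i; under eq_fun do rewrite mxE;
    exact: measurable_cV_coord.
have mds : measurable_fun [set: 'cV[R]_(m + l)] (fun z => dsubmx z : 'cV[R]_l).
  by apply: measurable_fun_cV => i; under eq_fun do rewrite mxE;
    exact: measurable_cV_coord.
have mD : measurable_fun [set: measurableTypeR R * 'cV[R]_(m + l)] D.
  have h1 : measurable_fun [set: measurableTypeR R * 'cV[R]_(m + l)]
     (fun u : measurableTypeR R * 'cV[R]_(m + l) => (u.1 : R) *:
       (dsubmx u.2 : 'cV[R]_l)).
    by apply: measurable_cV_scale;
      [exact: measurable_fst|exact: (measurableT_comp mds measurable_snd)].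
  have h2 : measurable_fun [set: measurableTypeR R * 'cV[R]_(m + l)]
     (fun u : measurableTypeR R * 'cV[R]_(m + l) => (usubmx u.2 : 'cV[R]_m)).
    exact: (measurableT_comp mus measurable_snd).
  exact: (measurableT_comp (@measurable_col_mx R m l) (measurable_fun_pair h2 h1)).
pose Y : set (measurableTypeR R * 'cV[R]_(m + l)) := [set u | 0 < (u.1 : R) /\ Z (D u)].
have mY : measurable Y.
  rewrite (_ : Y = (setT `&` fst @^-1` (`]0, +oo[%classic : set
    (measurableTypeR R))) `&` (setT `&` D @^-1` Z)).
    by apply: measurableI; [exact: measurable_fst|exact: mD].
  by apply/seteqP; split => u; rewrite /Y /= in_itv/= andbT;
    [move=> []|move=> [[_ ?] [_ ?]]].
pose f (u : measurableTypeR R * 'cV[R]_(m + l)) := (\1_Y u)%:E : \bar R.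
have mf : measurable_fun setT f by apply/measurable_EFinP; exact: measurable_indic.
have f0 u : (0 <= f u)%E by rewrite lee_fin.
pose J (z : 'cV[R]_(m + l)) := (\int[@lebesgue_measure R]_t f (t, z))%E.
have mJ : measurable_fun setT J.
  exact: (@measurable_fun_fubini_tonelli_G _ _ (measurableTypeR R) _ R
    (@lebesgue_measure R) f mf f0).
have intJ : (\int[lebesgue_cV R (m + l)]_z J z = 0)%E.
  rewrite /J -(@fubini_tonelli _ _ (measurableTypeR R) _ R (@lebesgue_measure R)
    (lebesgue_cV R (m + l)) f mf f0).
  rewrite integral0_eq// => t _.
  have [t0|t0] := ltP 0 (t : R); last first.
    rewrite integral0_eq// => z _; rewrite /f indicE memNset// /Y/= => -[].
    by rewrite ltNge t0.
  rewrite integral_lebesgue_cV_col; last 2 first.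
  - exact: (measurableT_comp mf (measurable_pair1 (t : measurableTypeR R))).
  - by [].
  have ind_eq (x : 'cV[R]_m) (y : 'cV[R]_l) : f (t, col_mx x y) =
      (\1_Z (col_mx x ((t : R) *: y) : 'cV[R]_(m + l)))%:E.
    rewrite /f !indicE; congr ((_ %:R)%:E); congr nat_of_bool.
    by apply/idP/idP; rewrite !inE /Y /D/= col_mxKu col_mxKd// => -[].
  have mZx (x : 'cV[R]_m) : measurable_fun setT
    (fun y : 'cV[R]_l => (\1_Z (col_mx x y : 'cV[R]_(m + l)))%:E : \bar R).
    apply/measurable_EFinP.
    exact: (measurableT_comp (measurable_indic mZ)
      (measurableT_comp (@measurable_col_mx R m l) (measurable_pair1 x))).
  under eq_integral => x _.
    under eq_integral do rewrite ind_eq.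
    rewrite (@integral_lebesgue_cV_scale R l t
      (fun y => (\1_Z (col_mx x y : 'cV[R]_(m + l)))%:E) t0)//.
    over.
  have mZi : measurable_fun setT (fun z : 'cV[R]_(m + l) => (\1_Z z)%:E : \bar R).
    by apply/measurable_EFinP; exact: measurable_indic.
  rewrite ge0_integralZl//; last 3 first.
  - by apply: (measurable_integral_col mZi) => z; rewrite lee_fin.
  - by move=> x _; apply: integral_ge0.
  - by rewrite lee_fin exprn_ge0// invr_ge0 ltW.
  by rewrite -(@integral_lebesgue_cV_col R m l (fun z => (\1_Z z)%:E))//
    integral_indic// setIT [X in (_ * X)%E]Z0 mule0.
pose W := [set z : 'cV[R]_(m + l) | 0 < enorm (usubmx z : 'cV[R]_m) /\ 0 < enorm
  (dsubmx z : 'cV[R]_l)].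
have mpos k := @measurable_enorm_gt0 R k.
have mW : measurable W.
  rewrite (_ : W = (setT `&` (fun z => usubmx z : 'cV[R]_m) @^-1` [set z | 0 <
    enorm z]) `&`
    (setT `&` (fun z => dsubmx z : 'cV[R]_l) @^-1` [set z | 0 < enorm z])); last first.
    by apply/seteqP; split => z; rewrite /W /=; [move=> []|move=> [[_ ?] [_ ?]]].
  by apply: measurableI; [apply: mus => //; exact: mpos|apply: mds => //; exact: mpos].
have W0 : (0 < lebesgue_cV R (m + l) W)%E.
  rewrite -[X in lebesgue_cV _ _ X]setIT -integral_indic// integral_lebesgue_cV_col;
    last 2 first.
  - by apply/measurable_EFinP; exact: measurable_indic.
  - by move=> z; rewrite lee_fin indicE.
  have ind_eq (x : 'cV[R]_m) (y : 'cV[R]_l) : (\1_W (col_mx x y : 'cV[R]_(m + l)))%:E =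
     ((\1_[set z : 'cV[R]_m | (0 < enorm z)%R] x)%:E * (\1_[set z : 'cV[R]_l |
       (0 < enorm z)%R] y)%:E)%E :> \bar R.
    rewrite -EFinM !indicE -natrM mulnb; congr ((_ %:R)%:E); congr nat_of_bool.
    by apply/idP/andP; rewrite !inE /W/= col_mxKu col_mxKd.
  under eq_integral => x _.
    under eq_integral do rewrite ind_eq.
    rewrite ge0_integralZl//; last by apply/measurable_EFinP;
      apply: measurable_indic; exact: mpos.
    rewrite integral_indic//; last exact: mpos.
    rewrite setIT.
    over.
  rewrite ge0_integralZr//; last by apply/measurable_EFinP; apply: measurable_indic;
    exact: mpos.
  rewrite integral_indic//; last exact: mpos.
  by rewrite setIT; apply: mule_gt0; exact: lebesgue_cV_enorm_gt0.
(* otherwise J would be positive on W, which is not null *)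
have [z [[Wx Wy] Jz]] : exists z, W z /\ J z = 0%E.
  apply: contrapT => nz; move: W0;
    rewrite (@integral0_null _ _ _ (lebesgue_cV R (m + l)) W J) ?ltxx//.
  - exact: measurable_funS mJ.
  - move=> z Wz; rewrite lt_neqAle integral_ge0// andbT; apply/eqP => J0.
    by apply: nz; exists z.
  - apply/eqP; rewrite eq_le integral_ge0 ?andbT//; last by move=> z _;
    apply: integral_ge0.
    rewrite -intJ ge0_subset_integral// => z _; exact: integral_ge0.
pose M := [set t : R | 0 < t /\ Z (col_mx (usubmx z) (t *: dsubmx z))].
have mM : measurable M.
  have := measurable_ysection z mY.
  rewrite (_ : ysection _ _ = M)//.
  by apply/seteqP; split => t; rewrite /ysection/= inE.
exists (usubmx z), (dsubmx z); split => //.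
by rewrite -[RHS]Jz /J /f -/M -[M]setIT -integral_indic.
Qed.

(** The inverse of t |-> t^2 / (1 + t^2) on ]0, 1[. *)
Definition slope (R : realType) (s : R) : R := Num.sqrt s / Num.sqrt (1 - s).

Lemma measurable_slope (R : realType) : measurable_fun [set: R] (@slope R).
Proof.
have ms : measurable_fun [set: R] (@Num.sqrt R)
  by exact: (continuous_measurable_fun (@sqrt_continuous R)).
apply: measurable_funM => //.
under eq_fun do rewrite -powR_inv1 ?sqrtr_ge0//.
apply: (measurableT_comp (measurable_powR (-1))).
by apply: (measurableT_comp ms); exact: measurable_funB.
Qed.

Lemma slopeK (R : realType) (t : R) : 0 <= t -> slope (1 - (1 + t ^+ 2)^-1) = t.
Proof.
move=> t0; have [r0 e1 e2] := sqr_ratio_sqrt t.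
set r := Num.sqrt (1 + t ^+ 2) in r0 e1 e2.
rewrite /slope e1 e2 !sqrtr_sqr !ger0_norm ?invr_ge0 ?divr_ge0 ?(ltW r0)//.
by rewrite invrK mulfVK// gt_eqF.
Qed.

Lemma slope_gt0 (R : realType) (s : R) : 0 < s < 1 -> 0 < slope s.
Proof. by move=> /andP[s0 s1]; rewrite divr_gt0 ?sqrtr_gt0 ?subr_gt0. Qed.

(** In the variable t = slope s the set becomes the dilation by 1 / c of a null
    set. *)
Lemma slope_null (R : realType) (c : R) (M : set R) : 0 < c -> measurable M ->
  lebesgue_measure M = 0%E ->
  lebesgue_measure (`]0, 1[ `&` (fun s => c * slope s) @^-1` M) = 0%E.
Proof.
move=> c0 mM M0.
have mcs : measurable_fun [set: R] (fun s : R => c * slope s).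
  by apply: measurable_funM => //; exact: measurable_slope.
have mQ : measurable (`]0, 1[ `&` (fun s => c * slope s) @^-1` M).
  by apply: measurableI => //; rewrite -[X in measurable X]setTI; exact: mcs.
have mh : measurable_fun [set: R] (fun t : R => 1 - (1 + t ^+ 2)^-1).
  exact: continuous_measurable_fun (is_derive_continuous (@is_derive_sqr_ratio R)).
have mc : measurable_fun [set: R] (fun t : R => c * t) by exact: measurable_funM.
have mcM : measurable ((fun t => c * t) @^-1` M) by rewrite -[X in measurable
  X]setTI; exact: mc.
rewrite -[X in lebesgue_measure X](@setIidl _ _ `[0, 1[%classic); last first.
  by move=> s [/= + _]; rewrite !in_itv/= => /andP[/ltW -> ->].
rewrite subst_sqr_ratio//.
rewrite (@ge0_negligible_integral _ (measurableTypeR R) R (@lebesgue_measure R) _ _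
  _ mcM)//; last 4 first.
- apply: measurableI => //.
  by rewrite -[X in measurable X]setTI; exact: mh.
- by apply/measurable_EFinP; exact: (measurable_funS measurableT _
  (@measurable_sqr_ratio_derive R)).
- by move=> t [/= + _]; rewrite in_itv/= andbT => t0; rewrite lee_fin;
  apply: divr_ge0; [exact: mulr_ge0|exact: sqr_ge0].
- by apply: (etrans (lebesgue_measure_scale c0 mM)); rewrite M0 mule0.
rewrite (_ : _ `\` _ = set0) ?integral_set0//.
apply/seteqP; split => // t [[/= + [_ +]]]; rewrite in_itv/= andbT => t0.
by rewrite slopeK.
Qed.

(** The whole infinite cone over [N], as a union of dilations of the cone of
    height one by which areas are defined. *)
Definition blowup (R : realType) n (N : set 'cV[R]_n) : set 'cV[R]_n :=
  \bigcup_k (fun z => (k.+1%:R^-1 : R) *: z) @^-1` sphere_cone N.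

Lemma blowup_null (R : realType) n (N : set 'cV[R]_n) : (0 < n)%N -> measurable N ->
  surface_borel N = 0%E -> measurable (blowup N) /\ lebesgue_cV R n (blowup N) = 0%E.
Proof.
move=> n0 mN N0.
have mk k : measurable ((fun z : 'cV[R]_n => (k.+1%:R^-1 : R) *: z) @^-1`
  sphere_cone N).
  rewrite -[X in measurable X]setTI.
  apply: (measurable_cV_scale (measurable_cst _) (@measurable_id _ 'cV[R]_n setT))
    => //.
  exact: measurable_sphere_cone.
have mB : measurable (blowup N) by exact: bigcupT_measurable.
split => //; apply/eqP; rewrite -measure_le0.
apply: (le_trans (measure_sigma_subadditive (lebesgue_cV R n) mk mB
  (@subset_refl _ _))).
have coneN0 : lebesgue_cV R n (sphere_cone N) = 0%E.
  by move: N0 => /eqP; rewrite /surface_borel mule_eq0 eqe pnatr_eq0 gtn_eqF//= => /eqP.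
rewrite eseries0// => k _ _.
have k0 : 0 < k.+1%:R^-1 :> R by rewrite invr_gt0.
by apply: (etrans (lebesgue_cV_scale k0 (measurable_sphere_cone mN)));
  rewrite coneN0 mule0.
Qed.

Lemma blowup_scale (R : realType) n (N : set 'cV[R]_n) (r : R) (t : 'cV[R]_n) :
  0 < r -> N t -> unit_sphere t -> blowup N (r *: t).
Proof.
move=> r0 Nt St; exists (Num.truncn r) => //=; exists ((Num.truncn r).+1%:R^-1 * r).
  rewrite /= mulr_gt0 ?invr_gt0//= ler_pdivrMl// mulr1.
  exact/ltW/truncnS_gt.
by exists t => //; rewrite scalerA.
Qed.

(** Let [E] and [F] be Borel sets around the preimage of [A] with [F] minus [E]
    of area zero. The cone over [F] minus [E] is null, hence so is the set of
    times at which a suitable ray t |-> (x, t y) meets it. Along this ray s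
    takes every value of ]0, 1[ once, so the curve [P], which follows the
    projection of the ray to the sphere at parameter s, pulls [E] and [F] back
    to Borel sets around the trace of [A] on ]0, 1[ whose difference is null. *)
Lemma sparam_completed_converse (R : realType) m l (A : set R) : (0 < m)%N ->
  (0 < l)%N ->
  measurable (unit_sphere `&` @sparam R (m + l) l @^-1` A : set (sphereT R (m + l))) ->
  measurable (A `&` `[0, 1] : set (lebesgueT R)).
Proof.
move=> m0 l0 mSA.
have ml0 : (0 < m + l)%N by rewrite addn_gt0 m0.
have [E [F [mE mF ES SF FE0]]] := cara_sandwich (@surface_borel_lty R (m + l)) mSA.
have mN : measurable (F `\` E) by exact: measurableD.
have [mB B0] := blowup_null ml0 mN FE0.
have [x [y [x0 y0 mM M0]]] := exists_null_ray m0 l0 mB B0.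
pose xh := (enorm x)^-1 *: x; pose yh := (enorm y)^-1 *: y.
have xh1 : dot xh xh = 1.
  by rewrite -sqr_enorm enormZ ?invr_ge0 ?enorm_ge0// mulVf ?expr1n// gt_eqF.
have yh1 : dot yh yh = 1.
  by rewrite -sqr_enorm enormZ ?invr_ge0 ?enorm_ge0// mulVf ?expr1n// gt_eqF.
pose P (s : R) : 'cV[R]_(m + l) := col_mx (Num.sqrt (1 - s) *: xh) (Num.sqrt s *: yh).
have sP s : 0 <= s <= 1 -> sparam l (P s) = s.
  by move=> /andP[s0 _]; rewrite sparam_col_mx dotZ yh1 mulr1 sqr_sqrtr.
have SP s : 0 <= s <= 1 -> unit_sphere (P s).
  move=> /andP[s0 s1]; apply/eqP; rewrite -(@eqrXn2 _ 2)// ?enorm_ge0//; apply/eqP.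
  rewrite enorm_col_mx !sqr_enorm (dotZ _ xh) (dotZ _ yh) xh1 yh1 !mulr1 !sqr_sqrtr
    ?subr_ge0//.
  by rewrite expr1n subrK.
have ms : measurable_fun [set: R] (@Num.sqrt R)
  by exact: (continuous_measurable_fun (@sqrt_continuous R)).
have mP : measurable_fun [set: R] P.
  have h1 : measurable_fun [set: R] (fun s : R => Num.sqrt (1 - s) *: xh).
    apply: measurable_cV_scale; last exact: measurable_cst.
    by apply: (measurableT_comp ms); exact: measurable_funB.
  have h2 : measurable_fun [set: R] (fun s : R => Num.sqrt s *: yh).
    by apply: measurable_cV_scale => //; exact: measurable_cst.
  exact: (measurableT_comp (@measurable_col_mx R m l) (measurable_fun_pair h1 h2)).
have mPB Z : measurable Z -> measurable (`]0, 1[%classic `&` P @^-1` Z).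
  by move=> mZ; apply: measurableI => //; rewrite -[X in measurable X]setTI; exact: mP.
have sub01 (s : R) : `]0, 1[%classic s -> 0 <= s <= 1.
  by rewrite /= in_itv/= => /andP[/ltW -> /ltW ->].
(* the ray reaches parameter s at time c * slope s *)
pose c := enorm x / enorm y.
have c0 : 0 < c by rewrite divr_gt0.
pose Q : set R := `]0, 1[%classic `&` P @^-1` (F `\` E); pose T : set R := [set 0; 1].
have diff0 : lebesgue_measure Q = 0%E.
  apply/eqP; rewrite -measure_le0 -(slope_null c0 mM M0).
  have mcs : measurable_fun [set: R] (fun s : R => c * slope s).
    by apply: measurable_funM => //; exact: measurable_slope.
  rewrite le_measure ?inE//.
  - exact: mPB.
  - by apply: measurableI => //; rewrite -[X in measurable X]setTI; exact: mcs.
  move=> s [s01 Ns]; split => //=.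
  have /andP[s0 s1] : 0 < s < 1 by move: s01; rewrite /= in_itv.
  have q0 : 0 < Num.sqrt (1 - s) by rewrite sqrtr_gt0 subr_gt0.
  split; first by rewrite mulr_gt0// slope_gt0// s0.
  rewrite (_ : col_mx _ _ = (enorm x / Num.sqrt (1 - s)) *: P s).
    apply: blowup_scale => //; first by rewrite divr_gt0.
    exact/SP/sub01.
  rewrite /P /xh /yh scale_col_mx !scalerA; congr col_mx.
    by rewrite mulfVK ?mulfV ?scale1r// gt_eqF.
  by rewrite /c /slope; congr (_ *: y); field; rewrite !gt_eqF.
apply/lebesgue_caraP; exists (`]0, 1[%classic `&` P @^-1` E),
  ((A `&` `[0, 1]) `\` (`]0, 1[ `&` P @^-1` E)),
  (Q `|` T).
have fin0 : lebesgue_measure T = 0%E.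
  by rewrite /T; apply: countable_lebesgue_measure0; exact: finite_set_countable.
have m2 : measurable T by rewrite /T; exact: measurableU.
split.
- exact: mPB.
- by apply: measurableU => //; exact: mPB.
- apply/eqP; rewrite -measure_le0.
  have h : (lebesgue_measure (Q `|` T) <= lebesgue_measure Q + lebesgue_measure T)%E.
    by apply: measureU2 => //; exact: mPB.
  by rewrite diff0 fin0 adde0 in h.
- move=> s [[As]]; rewrite /= in_itv/= => /andP[].
  rewrite le_eqVlt => /predU1P[<- _ _|s0]; first by right; left.
  rewrite le_eqVlt => /predU1P[-> _|s1 nE]; first by right; right.
  have s01 : `]0, 1[%classic s by rewrite /= in_itv/= s0.
  left; split => //; split.
    apply: SF; split; first exact/SP/sub01.
    by rewrite /= sP//; exact: sub01.
  by move=> EP; apply: nE.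
- rewrite setDUK// => s [s01 /ES[_]]; rewrite /= sP; last exact: sub01.
  by move=> As; split => //; rewrite in_itv/=; exact: sub01.
Qed.

(** * Orbits of the group and the angle to the coordinate subspace *)

Lemma dot_subZ (R : realType) k (c : R) (y w : 'cV[R]_k) :
  dot (y - c *: w) (y - c *: w) = dot y y - 2 * c * dot y w + c ^+ 2 * dot w w.
Proof.
rewrite !dotE !mulr_sumr -sumrB -big_split/=; apply: eq_bigr => i _.
by rewrite !mxE; ring.
Qed.

Lemma dot_eq0 (R : realType) k (z : 'cV[R]_k) : dot z z = 0 -> z = 0.
Proof.
move=> /eqP; rewrite dotE psumr_eq0; last by move=> i _; rewrite -expr2 sqr_ge0.
move=> /allP z0; apply/matrixP => i j; rewrite (ord1 j) mxE.
by have := z0 i (mem_index_enum _); rewrite -expr2 sqrf_eq0 => /eqP.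
Qed.

(** The Householder reflection in the hyperplane orthogonal to x - x'. *)
Lemma orthogonal_transitive (R : realType) k (x x' : 'cV[R]_k) : dot x x = dot x' x' ->
  exists a : 'M[R]_k, orthogonal_mx a /\ a *m x = x'.
Proof.
move=> xx; pose u := x - x'; pose c := dot u u.
have uu : u^T *m u = c%:M by rewrite [LHS]mx11_scalar.
have [c0|c0] := eqVneq c 0.
  exists 1%:M; split; first by rewrite /orthogonal_mx/= trmx1 mulmx1.
  by rewrite mul1mx; apply/eqP; rewrite -subr_eq0; apply/eqP/dot_eq0.
have ux : u^T *m x = (c / 2)%:M.
  rewrite [LHS]mx11_scalar; congr (_%:M); rewrite -/(dot u x).
  have := dot_subZ 1 x x'; rewrite scale1r -/u -/c => ->.
  have -> : dot u x = dot x x - dot x x'.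
    by rewrite !dotE -sumrB; apply: eq_bigr => i _; rewrite !mxE; ring.
  by rewrite -xx; field.
exists (1%:M - (2 / c) *: (u *m u^T)); split.
  rewrite /orthogonal_mx/=.
  have -> : (1%:M - (2 / c) *: (u *m u^T))^T = 1%:M - (2 / c) *: (u *m u^T).
    by rewrite linearB/= linearZ/= trmx1 trmx_mul trmxK.
  rewrite mulmxBl mul1mx mulmxBr mulmx1 -scalemxAl -scalemxAr mulmxA -(mulmxA u) uu.
  rewrite mul_mx_scalar -scalemxAl !scalerA opprB addrC -addrA.
  rewrite (_ : 2 / c * (2 / c * c) = 2 / c + 2 / c); last by field.
  rewrite scalerDl; set v := (2 / c) *: _.
  by rewrite addrACA subrr add0r addrC subrK.
rewrite mulmxBl mul1mx -scalemxAl -mulmxA ux mul_mx_scalar scalerA.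
rewrite (_ : 2 / c * (c / 2) = 1); last by field.
by rewrite scale1r /u opprB addrCA subrr addr0.
Qed.

(** For n = m + l the embeddings of the two blocks are those of [block_mx]. *)
Lemma K_group_block (R : realType) m l (g : 'M[R]_(m + l)) :
  K_group l g <-> exists (a : 'M[R]_m) (b : 'M[R]_l),
    [/\ orthogonal_mx a, orthogonal_mx b & g = block_mx a 0 0 b].
Proof.
rewrite /K_group/=; move: (addnK l m); move: (m + l - l)%N => k ek; subst k; split.
  by move=> [e [a [b [oa ob ->]]]]; exists a, b; split => //; rewrite castmx_id.
by move=> [a [b [oa ob ->]]]; exists erefl, a, b; split => //; rewrite castmx_id.
Qed.

Lemma dot_orthogonal (R : realType) k (a : 'M[R]_k) (x : 'cV[R]_k) : orthogonal_mx a ->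
  dot (a *m x) (a *m x) = dot x x.
Proof. by move=> oa; rewrite /dot trmx_mul mulmxA -(mulmxA x^T) oa mulmx1. Qed.

Lemma mul_block_col_diag (R : realType) m l (a : 'M[R]_m) (b : 'M[R]_l)
  (x : 'cV[R]_m) (y : 'cV[R]_l) :
  block_mx a 0 0 b *m col_mx x y = col_mx (a *m x) (b *m y).
Proof. by rewrite mul_block_col !mul0mx addr0 add0r. Qed.

Lemma K_group_sparam (R : realType) m l (g : 'M[R]_(m + l)) (t : 'cV[R]_(m + l)) :
  K_group l g -> unit_sphere t -> unit_sphere (g *m t) /\ sparam l (g *m t) =
    sparam l t.
Proof.
move=> /K_group_block[a [b [oa ob ->]]];
  rewrite -[t]vsubmxK mul_block_col_diag !sparam_col_mx.
by rewrite /unit_sphere/= /enorm !dot_col_mx !dot_orthogonal.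
Qed.

(** On the sphere s determines the lengths of both components of t, and each
    orthogonal group is transitive on vectors of a given length. *)
Lemma K_orbit_representative (R : realType) m l (t : 'cV[R]_(m + l)) (e : 'cV[R]_m)
  (e' : 'cV[R]_l) :
  dot e e = 1 -> dot e' e' = 1 -> unit_sphere t ->
  exists2 g, K_group l g &
   g *m t = col_mx (Num.sqrt (1 - sparam l t) *: e) (Num.sqrt (sparam l t) *: e').
Proof.
move=> e1 e'1; rewrite -[t]vsubmxK; set x := usubmx t; set y := dsubmx t => St.
rewrite sparam_col_mx.
have xE : dot x x = 1 - dot y y.
  move: St; rewrite /unit_sphere/= => /(congr1 (fun r => r ^+ 2)).
  by rewrite sqr_enorm dot_col_mx expr1n => <-; rewrite addrK.
have [a [oa ax]] : exists a : 'M[R]_m, orthogonal_mx a /\ a *m x =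
  Num.sqrt (1 - dot y y) *: e.
  by apply: orthogonal_transitive; rewrite dotZ e1 mulr1 -xE sqr_sqrtr// dot_ge0.
have [b [ob bx]] : exists b : 'M[R]_l, orthogonal_mx b /\ b *m y =
  Num.sqrt (dot y y) *: e'.
  by apply: orthogonal_transitive; rewrite dotZ e'1 mulr1 sqr_sqrtr// dot_ge0.
exists (block_mx a 0 0 b); first by apply/K_group_block; exists a, b.
by rewrite mul_block_col_diag ax bx.
Qed.

Lemma unit_vector (R : realType) k : (0 < k)%N -> exists e : 'cV[R]_k, dot e e = 1.
Proof.
case: k => // k _; exists (delta_mx ord0 ord0).
rewrite dotE (bigD1 ord0)//= big1; last by move=> i /negbTE i0; rewrite mxE i0 mul0r.
by rewrite mxE !eqxx mulr1 addr0.
Qed.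

(** Cauchy-Schwarz, from the square of y - (y . w) w. *)
Lemma dot_le_enorm (R : realType) k (y w : 'cV[R]_k) : dot w w = 1 ->
  `|dot y w| <= enorm y.
Proof.
move=> w1; rewrite -(ler_pXn2r (ltn0Sn 1)) ?nnegrE ?enorm_ge0// sqr_enorm real_normK
  ?num_real//.
have := dot_ge0 (y - dot y w *: w); rewrite dot_subZ w1 mulr1; lra.
Qed.

(** The minimum of the angles is attained at the direction of the orthogonal
    projection of t, and at every direction when this projection is zero. *)
Lemma cos_angle (R : realType) m l (t : 'cV[R]_(m + l)) : (0 < l)%N -> unit_sphere t ->
  Num.sqrt (sparam l t) = cos (angle t (coord_subspace l)).
Proof.
move=> l0; rewrite -[t]vsubmxK; set x := usubmx t; set y := dsubmx t => St.
rewrite sparam_col_mx -/(enorm y).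
have y1 : enorm y <= 1.
  rewrite -(@expr_le1 _ 2) ?enorm_ge0//; move: St;
    rewrite /unit_sphere/= => /(congr1 (fun r => r ^+ 2)).
  by rewrite enorm_col_mx expr1n => <-; rewrite lerDr sqr_ge0.
have y0 := enorm_ge0 y.
suff -> : angle (col_mx x y) (coord_subspace l) = acos (enorm y).
  by rewrite acosK// in_itv/= y1 (le_trans _ y0)// lerN10.
have dot0 (w : 'cV[R]_l) : dot (col_mx x y) (col_mx 0 w) = dot y w.
  by rewrite dot_col_mx /dot mulmx0 mxE add0r.
have inV (w : 'cV[R]_l) : coord_subspace l (col_mx (0 : 'cV[R]_m) w).
  move=> i; rewrite addnK => im.
  by rewrite (_ : i = lshift l (Ordinal im)) ?col_mxEu ?mxE//; exact: val_inj.
have enorm0 (w : 'cV[R]_l) : enorm (col_mx (0 : 'cV[R]_m) w) = enorm w.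
  by rewrite /enorm dot_col_mx {1}/dot mulmx0 mxE add0r.
have dotE1 (w : 'cV[R]_l) : enorm w = 1 -> dot w w = 1.
  by move=> w1; rewrite -sqr_enorm w1 expr1n.
rewrite /angle; set S := [set acos (dot (col_mx x y) v) | v in _].
have lbS : lbound S (acos (enorm y)).
  move=> _ [v [Vv Sv] <-].
  have vE : v = col_mx 0 (dsubmx v).
    rewrite -[LHS]vsubmxK; congr col_mx; apply/matrixP => i j.
    by rewrite (ord1 j) mxE Vv ?mxE// addnK/= ltn_ord.
  have w1 : dot (dsubmx v) (dsubmx v) = 1.
    by apply: dotE1; rewrite -enorm0 -vE.
  have dv : dot (col_mx x y) v = dot y (dsubmx v) by rewrite {1}vE dot0.
  have := dot_le_enorm y w1; rewrite dv ler_norml => /andP[d1 d2].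
  have d1' : -1 <= dot y (dsubmx v) by rewrite (le_trans _ d1)// lerN2.
  have d2' : dot y (dsubmx v) <= 1 by rewrite (le_trans d2).
  have yN1 : -1 <= enorm y by rewrite (le_trans _ y0)// lerN10.
  rewrite leNgt; apply/negP; rewrite -ltr_cos ?in_itv/= ?acos_ge0 ?acos_lepi
    ?yN1 ?d1'//.
  by rewrite !acosK ?in_itv/= ?yN1 ?d1'// ltNge d2.
have [w [w1 yw]] : exists w : 'cV[R]_l, enorm w = 1 /\ dot y w = enorm y.
  have [yz|yz] := eqVneq (enorm y) 0.
    have [e e1] := @unit_vector R l l0.
    exists e; split; first by rewrite /enorm e1 sqrtr1.
    have y00 : y = 0 by apply: dot_eq0; rewrite -sqr_enorm yz expr0n.
    by rewrite yz y00 /dot trmx0 mul0mx mxE.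
  exists ((enorm y)^-1 *: y); split; first by rewrite enormZ ?invr_ge0// mulVf.
  by rewrite /dot -scalemxAr mxE -/(dot y y) -sqr_enorm expr2 mulKf.
have Sa : S (acos (enorm y)).
  by exists (col_mx 0 w); [split => //; rewrite /unit_sphere/= enorm0|rewrite dot0 yw].
apply/eqP; rewrite eq_le; apply/andP; split.
  by apply: ge_inf => //; exists (acos (enorm y)).
by apply: lb_le_inf => //; exists (acos (enorm y)).
Qed.

(** * The theorem *)

Section signed.
Local Open Scope ereal_scope.
Context (R : realType) (m l : nat) (m0 : (0 < m)%N) (l0 : (0 < l)%N) (f0 : R -> R).
Context (if0 : (nu R (m + l) l).-integrable `[0%R, 1%R] (EFin \o f0)).

Let mI : measurable (`[0%R, 1%R]%classic : set (lebesgueT R)).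
Proof. exact: lebesgue_cara_measurable. Qed.

Let mf0 : measurable_fun (`[0%R, 1%R]%classic : set (lebesgueT R)) (EFin \o f0).
Proof. exact: measurable_int if0. Qed.

Let posfin : \int[nu R (m + l) l]_(s in `[0%R, 1%R]) (EFin \o f0)^\+ s \is a fin_num.
Proof. exact: integrable_pos_fin_num. Qed.

Let negfin : \int[nu R (m + l) l]_(s in `[0%R, 1%R]) (EFin \o f0)^\- s \is a fin_num.
Proof. exact: integrable_neg_fin_num. Qed.

(** Difference of the formulas for the positive and negative parts, both finite.
    *)
Lemma integral_sparam_signed :
  \int[surface_measure R (m + l)]_(t in unit_sphere) (f0 (sparam l t))%:E =
  (sigma R m.-1 * sigma R l.-1 / 2)%:E * \int[nu R (m + l) l]_(s in `[0%R,
    1%R]) (f0 s)%:E.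
Proof.
rewrite integralE [in RHS]integralE muleBr//; last first.
  by rewrite fin_num_adde_defr.
congr (_ - _).
  rewrite -(integral_sparam m0 l0 (measurable_funepos mf0)
    (fun s _ => funepos_ge0 _ s)).
  by apply: eq_integral => t _; rewrite !funeposE.
rewrite -(integral_sparam m0 l0 (measurable_funeneg mf0) (fun s _ => funeneg_ge0 _ s)).
by apply: eq_integral => t _; rewrite !funenegE.
Qed.

Lemma integral_angle_signed :
  \int[@completed_lebesgue_measure R]_(w in `[0%R, (pi / 2)%R])
    (f0 (cos w ^+ 2) * sin w ^+ m.-1 * cos w ^+ l.-1)%:E =
  (2^-1)%:E * \int[nu R (m + l) l]_(s in `[0%R, 1%R]) (f0 s)%:E.
Proof.
have half g : measurable_fun (`[0%R, 1%R]%classic : set (lebesgueT R)) g ->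
    (forall s, 0 <= g s) ->
    \int[@completed_lebesgue_measure R]_(w in `[0%R, (pi / 2)%R])
      (g (cos w ^+ 2)%R * (sin w ^+ m.-1 * cos w ^+ l.-1)%:E) =
    (2^-1)%:E * \int[nu R (m + l) l]_(s in `[0%R, 1%R]) g s.
  move=> mg g0; rewrite -ge0_integralZl//.
  rewrite (integral_angle (g := fun s => (2^-1)%:E * g s) m0 l0); last 2 first.
  - by apply: emeasurable_funM => //; exact: measurable_cst.
  - by move=> s _; rewrite mule_ge0.
  apply: eq_integral => w _; rewrite muleAC muleC; congr (_ * _).
  by rewrite -EFinM /angle_density mulKf.
rewrite integralE [in RHS]integralE muleBr//; last first.
  by rewrite fin_num_adde_defr.
congr (_ - _).
  rewrite -(half (EFin \o f0)^\+); [|exact: measurable_funepos mf0|by []].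
  apply: eq_integral => w /[!inE]/=; rewrite in_itv/= => /sin_cos_ge0[s0 c0].
  have a0 : (0 <= sin w ^+ m.-1 * cos w ^+ l.-1)%R by rewrite mulr_ge0// exprn_ge0.
  by rewrite !funeposE /= -mulrA EFinM maxeMl// mul0e.
rewrite -(half (EFin \o f0)^\-); [|exact: measurable_funeneg mf0|by []].
apply: eq_integral => w /[!inE]/=; rewrite in_itv/= => /sin_cos_ge0[s0 c0].
have a0 : (0 <= sin w ^+ m.-1 * cos w ^+ l.-1)%R by rewrite mulr_ge0// exprn_ge0.
by rewrite !funenegE /= -mulrA EFinM maxeMl// mul0e -!EFinM mulNr.
Qed.

End signed.

Theorem theorem1 (R : realType) (n l : nat)
    (hn : (2 <= n)%N) (hl : (1 <= l <= n - 1)%N) (f : 'cV[R]_n -> R)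
    (hf : (surface_measure R n).-integrable unit_sphere (EFin \o f)) :
  (K_invariant l f <->
    exists f0 : R -> R,
      (nu R n l).-integrable `[0, 1] (EFin \o f0) /\
      forall t, unit_sphere t -> f t = f0 (sparam l t)) /\
  (forall t : 'cV[R]_n, unit_sphere t ->
    Num.sqrt (sparam l t) = cos (angle t (coord_subspace l))) /\
  (forall f0 : R -> R,
    (nu R n l).-integrable `[0, 1] (EFin \o f0) ->
    (forall t, unit_sphere t -> f t = f0 (sparam l t)) ->
    let c : R := sigma R (l - 1) * sigma R (n - l - 1) in
    (\int[surface_measure R n]_(t in unit_sphere) (f t)%:E =
      c%:E * \int[@completed_lebesgue_measure R]_(w in `[0%R, (pi / 2)%R])
        (f0 (cos w ^+ 2) * sin w ^+ (n - l - 1) * cos w ^+ (l - 1))%:E)%E /\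
    (c%:E * \int[@completed_lebesgue_measure R]_(w in `[0%R, (pi / 2)%R])
        (f0 (cos w ^+ 2) * sin w ^+ (n - l - 1) * cos w ^+ (l - 1))%:E =
      (c / 2)%:E * \int[nu R n l]_(s in `[0%R, 1%R]) (f0 s)%:E)%E).
Proof.
have [m nE] : exists m, n = (m + l)%N.
  by exists (n - l)%N; rewrite subnK//; case/andP: hl => _ /leq_trans; apply;
    exact: leq_subr.
subst n.
have l0 : (0 < l)%N by case/andP: hl.
have m0 : (0 < m)%N.
  rewrite lt0n; apply/eqP => m_eq0; move: hl.
  by rewrite m_eq0 add0n subn1 [(l <= _)%N]leqNgt ltn_predL l0 andbF.
have mS : measurable (unit_sphere : set (sphereT R (m + l))).
  by apply: cara_measurable; exact: measurable_unit_sphere.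
split; [split|split].
- move=> Kf.
  have [e e1] := @unit_vector R m m0; have [e' e'1] := @unit_vector R l l0.
  (* evaluate f on one point of each orbit *)
  pose f0 (s : R) := f (col_mx (Num.sqrt (1 - s) *: e) (Num.sqrt s *: e')).
  have ff0 t : unit_sphere t -> f t = f0 (sparam l t).
    move=> St; have [g Kg gt] := K_orbit_representative e1 e'1 St.
    by rewrite /f0 -gt Kf.
  exists f0; split => //.
  have mf0 : measurable_fun (`[0%R, 1%R]%classic : set (lebesgueT R)) (EFin \o f0).
    move=> _ Y mY; rewrite setIC; apply: (sparam_completed_converse m0 l0).
    rewrite (_ : _ `&` _ = unit_sphere `&` (EFin \o f) @^-1` Y).
      exact: (measurable_int _ hf).
    by apply/seteqP; split => t [St]; rewrite /= ff0.
  apply/integrableP; split => //.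
  have /integrableP[_ foo] := hf.
  have K0 := surface_const_gt0 R m l.
  have mabs := measurableT_comp (@abse_measurable R setT) mf0.
  have E : (\int[surface_measure R (m + l)]_(t in unit_sphere) `|(EFin \o f) t| =
      (sigma R m.-1 * sigma R l.-1 / 2)%:E *
      \int[nu R (m + l) l]_(s in `[0%R, 1%R]) `|(EFin \o f0) s|)%E.
    rewrite -(integral_sparam m0 l0 mabs (fun s _ => abse_ge0 _)).
    by apply: eq_integral => t /[!inE] St; rewrite /= ff0.
  move: foo; rewrite E; have : (0 <= \int[nu R (m + l) l]_(s in `[0%R, 1%R])
    `|(EFin \o f0) s|)%E.
    exact: integral_ge0.
  case: (integral _ _ _) => [i _ _|_|//]; first by rewrite ltry.
  by rewrite mulry gtr0_sg// mul1e.
- move=> [f0 [_ ff0]] g t Kg St.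
  by have [Sgt sgt] := K_group_sparam Kg St; rewrite !ff0// sgt.
- by move=> t; exact: cos_angle.
- move=> f0 if0 ff0 c; rewrite addnK !subn1 in c *.
  rewrite (integral_angle_signed m0 l0 if0) muleA -EFinM; split => //.
  rewrite (_ : (c * 2^-1)%R = (sigma R m.-1 * sigma R l.-1 / 2)%R);
    last by rewrite /c mulrC; ring.
  rewrite -(integral_sparam_signed m0 l0 if0).
  by apply: eq_integral => t /[!inE] St; rewrite ff0.
Qed.
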